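(* Let $n\ge3$, $\alpha\in(0,n)$, $p,q>0$ with $pq>1$ and $p\le q$, and assume $\frac{1}{p+1}+\frac{1}{q+1}\le\frac{n-\alpha}{n}$. Let $(u,v)\in L^{r_0}(\mathbb{R}^n)\times L^{s_0}(\mathbb{R}^n)$, where $r_0=\frac{n(pq-1)}{\alpha(q+1)}$, $s_0=\frac{n(pq-1)}{\alpha(p+1)}$, be a pair of positive solutions of $$u(x)=\int_{\mathbb{R}^n}\frac{v^q(y)\,dy}{|x-y|^{n-\alpha}},\qquad v(x)=\int_{\mathbb{R}^n}\frac{u^p(y)\,dy}{|x-y|^{n-\alpha}}.$$ Then $(u,v)\in L^r(\mathbb{R}^n)\times L^s(\mathbb{R}^n)$ for all $r,s$ with $$\frac1r\in\Big(0,\frac{n-\alpha}{n}\Big),\qquad \frac1s\in\Big(0,\min\Big\{\frac{n-\alpha}{n},\frac{pn-(p+1)\alpha}{n}\Big\}\Big).$$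
   Context: Positive solutions are positive measurable functions satisfying both integral identities (finite) at every point. *)

(* Defs.v *)
From HB Require Import structures.
From mathcomp Require Import all_boot all_order all_algebra.
From mathcomp Require Import all_classical all_reals all_analysis.
Set Implicit Arguments. Unset Strict Implicit. Unset Printing Implicit Defensive.
Import Order.TTheory GRing.Theory Num.Theory.
Local Open Scope classical_set_scope.
Local Open Scope ring_scope.

Definition enorm {R : realType} {n : nat} (x : 'rV[R]_n) : R :=
  Num.sqrt (\sum_(i < n) (x ord0 i) ^+ 2).

Definition rectangles {R : realType} (n : nat) : set (set 'rV[R]_n) :=
  [set A | exists B : 'I_n -> set R,
      (forall i, measurable (B i)) /\ A = [set x : 'rV[R]_n | forall i, B i (x ord0 i)]].

Definition borel_n {R : realType} (n : nat) : set (set 'rV[R]_n) :=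
  <<s @rectangles R n >>.

Definition borel_fun {R : realType} {n : nat} (f : 'rV[R]_n -> R) : Prop :=
  forall B : set R, measurable B -> @borel_n R n (f @^-1` B).

(* Lebesgue integral over R^n of a [0,+oo]-valued function, defined as the
   iterated one-dimensional Lebesgue integral (equal to the integral w.r.t.
   n-dimensional Lebesgue measure for nonnegative Borel functions, Tonelli). *)
Fixpoint iint {R : realType} (n : nat) : ('rV[R]_n -> \bar R) -> \bar R :=
  match n return ('rV[R]_n -> \bar R) -> \bar R with
  | 0 => fun f => f 0
  | k.+1 => fun f =>
      (\int[@lebesgue_measure R]_(t in [set: R])
          iint (fun x : 'rV[R]_k => f (row_mx (\row_(j < 1) t) x)))%E
  end.

Definition riesz {R : realType} (n : nat) (alpha : R) (g : 'rV[R]_n -> R)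
    (x : 'rV[R]_n) : \bar R :=
  iint (fun y => ((g y) / (enorm (x - y) `^ (n%:R - alpha)))%:E).

Definition inLp {R : realType} (n : nat) (r : R) (f : 'rV[R]_n -> R) : Prop :=
  borel_fun f /\ (iint (fun x => (`|f x| `^ r)%:E) < +oo)%E.

(* Main.v *)
(** Write I for the Riesz potential.  Since u = I((I(u^p))^q) and
u^p = u^(p-1/q) u^(1/q), the function u is a fixed point of
f |-> I((I(u^(p-1/q) f^(1/q)))^q), which is homogeneous of degree one and, by
the Hardy-Littlewood-Sobolev and Hoelder inequalities, bounded on L^r for every
r with 1/r in (0, (n-alpha)/n): the exponent r0 makes the estimate scale
invariant.  Cutting the factor u^(p-1/q) down to the set where u is very small
or very large makes the operator a contraction on L^r and on L^r0 at once, while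
the remaining part of u lies in every L^r.  Iterating gives u <= max(E_k, G_k)
with E_k -> 0 in L^r0 and G_k bounded in L^r, hence u is in L^r; the claim on v
is then one more application of Hardy-Littlewood-Sobolev to v = I(u^p).

The Hardy-Littlewood-Sobolev inequality is obtained by duality: with the
normalisations |f|_a = |h|_t = 1, the form int int h(x) f(y) K(x,y) is split
according to whether h(x)^t or f(y)^a is the larger one, and each half is
controlled by int_{h <= H} h(y) K(x,y) dy <= C H^(1 - t alpha/n).  All of this
uses only that a ball of radius s has measure O(s^n). *)

Require Import Defs.
From HB Require Import structures.
From mathcomp Require Import all_boot all_order all_algebra.
From mathcomp Require Import all_classical all_reals all_analysis measurable_realfun.
From mathcomp Require Import ring lra.
Set Implicit Arguments.
Unset Strict Implicit.
Unset Printing Implicit Defensive.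
Import Order.TTheory GRing.Theory Num.Theory.
Import numFieldNormedType.Exports.
Local Open Scope classical_set_scope.
Local Open Scope ring_scope.

(** * Real powers and dyadic scales *)

Lemma powR_expR {R : realType} (a z : R) : 0 < a -> a `^ z = expR (z * ln a).
Proof. by move=> a0; rewrite /powR gt_eqF. Qed.

Lemma powRXn {R : realType} (a z : R) k : 0 <= a -> (a ^+ k) `^ z = (a `^ z) ^+ k.
Proof. by move=> a0; rewrite -powR_mulrn// powRAC powR_mulrn// powR_ge0. Qed.

Lemma powR_lt1 {R : realType} (a z : R) : 0 < a < 1 -> 0 < z -> 0 < a `^ z < 1.
Proof.
move=> /andP[a0 a1] z0; rewrite powR_gt0//= powR_expR// expR_lt1.
by rewrite pmulr_rlt0// ln_lt0// a0.
Qed.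

Lemma ler_powRN {R : realType} (a b z : R) : 0 <= z -> 0 < a -> a <= b ->
  b `^ (- z) <= a `^ (- z).
Proof.
move=> z0 a0 ab; have b0 := lt_le_trans a0 ab.
rewrite !powRN lef_pV2 ?posrE ?powR_gt0//.
by apply: ge0_ler_powR => //; rewrite nnegrE ltW.
Qed.

Lemma dyadic_ge1 {R : realType} (x : R) : 1 <= x ->
  exists k : nat, 2 ^+ k <= x < 2 ^+ k.+1.
Proof.
move=> x1; have x0 : 0 <= x by apply: le_trans x1.
have /andP[tl tr] := Num.Theory.truncn_itv x0.
have m0 : (0 < Num.truncn x)%N by rewrite Num.Theory.truncn_gt0.
have /andP[kl kr] := trunc_log_bounds (isT : (1 < 2)%N) m0.
exists (trunc_log 2 (Num.truncn x)); rewrite -!natrX; apply/andP; split.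
  by apply: le_trans tl; rewrite ler_nat.
by apply: lt_le_trans tr _; rewrite ler_nat.
Qed.

(** Each factor is at most the same power of the larger of [X] and [Y], and these two powers
    multiply to that larger number. *)
Lemma powR_AMGM {R : realType} (X Y t : R) : 0 <= X -> 0 <= Y -> 0 <= t <= 1 ->
  X `^ t * Y `^ (1 - t) <= X + Y.
Proof.
move=> X0 Y0 /andP[t0 t1].
have E (Z : R) : 0 <= Z -> Z `^ t * Z `^ (1 - t) = Z.
  move=> Z0; rewrite -powRD; last by rewrite addrC subrK oner_eq0.
  by rewrite addrC subrK powRr1.
have t1' : 0 <= 1 - t by lra.
case: (leP X Y) => XY.
  apply: (@le_trans _ _ (Y `^ t * Y `^ (1 - t))); last by rewrite E ?lerDr.
  by rewrite ler_wpM2r ?powR_ge0//; apply: ge0_ler_powR; rewrite ?nnegrE.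
apply: (@le_trans _ _ (X `^ t * X `^ (1 - t))); last by rewrite E ?lerDl.
rewrite ler_wpM2l ?powR_ge0//; apply: ge0_ler_powR; rewrite ?nnegrE//.
exact: ltW.
Qed.

(** Since |ln x| <= ln b, the factor x^(r - s) = exp((r - s) ln x) is at most b^|r - s|. Hence all
    powers of a function are comparable where it stays between 1/b and b. *)
Lemma powR_le_comparable {R : realType} (x b r s : R) : 1 <= b -> b^-1 <= x <= b ->
  x `^ r <= b `^ `|r - s| * x `^ s.
Proof.
move=> b1 /andP[bx xb]; have b0 : 0 < b by lra.
have x0 : 0 < x by apply: lt_le_trans bx; rewrite invr_gt0.
rewrite -[in leLHS](subrK s r) powRD; last by rewrite (gt_eqF x0) implybT.
rewrite ler_wpM2r ?powR_ge0//.
rewrite !powR_expR// ler_expR.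
have lnb : ln b >= 0 by rewrite ln_ge0.
have lx : `|ln x| <= ln b.
  rewrite ler_norml -lnV ?posrE// !ler_ln ?posrE ?invr_gt0//.
  by rewrite bx xb.
apply: le_trans (ler_norm _) _; rewrite normrM.
by rewrite ler_wpM2l.
Qed.

(** * Integrals of nonnegative real functions *)

(** Monotone convergence for truncations that are eventually exact at each point. A finite bound
    uniform in the truncation thereby yields integrability of [f]. *)
Lemma integral_le_lim {d} {T : measurableType d} {R : realType}
    (mu : {measure set T -> \bar R}) (k : nat -> T -> R) (f : T -> R) (M : \bar R) :
  (forall n, measurable_fun setT (k n)) -> (forall n x, 0 <= k n x) ->
  (forall x n m, (n <= m)%N -> k n x <= k m x) ->
  (forall x, \forall n \near \oo, k n x = f x) ->
  (forall n, \int[mu]_x (k n x)%:E <= M)%E ->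
  (\int[mu]_x (f x)%:E <= M)%E.
Proof.
move=> mk k0 ndk kf kM.
have kfE x : limn (fun n => (k n x)%:E) = (f x)%:E.
  apply: cvg_lim => //; apply: cvg_near_cst.
  by near=> n; congr (_%:E); near: n; exact: kf.
under eq_integral do rewrite -kfE.
rewrite monotone_convergence//; last 3 first.
- by move=> n; exact/measurable_EFinP.
- by move=> n x _; rewrite lee_fin.
- by move=> x _ n m nm; rewrite lee_fin ndk.
apply: lime_le; last exact: nearW.
apply: ereal_nondecreasing_is_cvgn => n m nm.
apply: ge0_le_integral => //; try (by move=> x _; rewrite lee_fin).
- exact/measurable_EFinP.
- exact/measurable_EFinP.
- by move=> x _; rewrite lee_fin ndk.
Unshelve. all: by end_near. Qed.

Section real_integrands.
Context {d : measure_display} {T : measurableType d} {R : realType}.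
Variable mu : {measure set T -> \bar R}.
Implicit Types f g : T -> R.

Lemma ge0_integralMl_fin f (a : R) : measurable_fun setT f ->
  (forall x, 0 <= f x) -> 0 <= a ->
  (\int[mu]_x (a * f x)%:E = a%:E * \int[mu]_x (f x)%:E)%E.
Proof.
move=> mf f0 a0; under eq_integral do rewrite EFinM.
by apply: ge0_integralZl_EFin => //;
  [move=> x _; rewrite lee_fin|exact/measurable_EFinP].
Qed.

Lemma ge0_integralD_fin f g : measurable_fun setT f -> (forall x, 0 <= f x) ->
  measurable_fun setT g -> (forall x, 0 <= g x) ->
  (\int[mu]_x (f x + g x)%:E = \int[mu]_x (f x)%:E + \int[mu]_x (g x)%:E)%E.
Proof.
move=> mf f0 mg g0; under eq_integral do rewrite EFinD.
by apply: ge0_integralD => //; do ?[exact/measurable_EFinP];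
  move=> x _; rewrite lee_fin.
Qed.

Lemma ge0_le_integral_fin f g : measurable_fun setT f -> (forall x, 0 <= f x) ->
  measurable_fun setT g -> (forall x, f x <= g x) ->
  (\int[mu]_x (f x)%:E <= \int[mu]_x (g x)%:E)%E.
Proof.
move=> mf f0 mg fg; apply: ge0_le_integral => //; do ?[exact/measurable_EFinP];
  by move=> x _; rewrite lee_fin.
Qed.

End real_integrands.

(** * The kernel D^-(N - al) when balls of radius s have measure O(s^N) *)

Section riesz_potential.
Context {d : measure_display} {T : measurableType d} {R : realType}.
Variable mu : {sigma_finite_measure set T -> \bar R}.
Variables (D : T -> T -> R) (N c : R).
Hypothesis D_sym : forall x y, D x y = D y x.
Hypothesis D_ge0 : forall x y, 0 <= D x y.
Hypothesis mD : measurable_fun setT (fun z : T * T => D z.1 z.2).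
Hypothesis N_gt0 : 0 < N.
Hypothesis c_gt0 : 0 < c.
Hypothesis mu_ball : forall x s, 0 < s ->
  (mu [set y | (D x y < s)%R] <= (c * s `^ N)%:E)%E.

Lemma measurable_dist x : measurable_fun setT (D x).
Proof. exact: (measurableT_comp mD (measurable_pair1 x)). Qed.

Lemma measurable_dball x s : measurable [set y | (D x y < s)%R].
Proof.
have := measurable_fun_ltr (measurable_dist x) (@measurable_cst _ _ _ _ setT s).
move=> /(_ measurableT [set true]); rewrite setTI; apply.
by [].
Qed.

(** [F] is dominated by the sum over k of a_k times the indicator of the ball of radius s_k about x,
    and the integral of that sum is at most the geometric series of c b t^k. *)
Lemma dyadic_integral (x : T) (F : T -> R) (a s : nat -> R) (b t : R) :
  measurable_fun setT F -> (forall y, 0 <= F y) ->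
  (forall k, 0 <= a k) -> (forall k, 0 < s k) -> 0 < t < 1 ->
  (forall k, a k * s k `^ N <= b * t ^+ k) ->
  (forall y, F y != 0 -> exists2 k, D x y < s k & F y <= a k) ->
  (\int[mu]_y (F y)%:E <= (c * b / (1 - t))%:E)%E.
Proof.
move=> mF F0 a0 s0 /andP[t0 t1] ab FE.
have b0 : 0 <= b.
  have := ab 0%N; rewrite expr0 mulr1; apply: le_trans.
  by rewrite mulr_ge0// powR_ge0.
pose B k : set T := [set y | (D x y < s k)%R].
pose g k y := ((a k)%:E * (\1_(B k) y)%:E)%E.
have mB k : measurable (B k) by exact: measurable_dball.
have mg k : measurable_fun setT (g k).
  apply: emeasurable_funM => //; apply/measurable_EFinP.
  exact: measurable_indic.
have g0 k y : (0 <= g k y)%E by rewrite mule_ge0 ?lee_fin.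
apply: (@le_trans _ _ (\int[mu]_y (\sum_(k <oo) g k y))%E).
  apply: ge0_le_integral => //.
  - by move=> y _; rewrite lee_fin.
  - exact/measurable_EFinP.
  - apply: ge0_emeasurable_sum => //.
  - move=> y _; have [->|/FE[k Dk Fk]] := eqVneq (F y) 0.
      by apply: nneseries_ge0.
    apply: (@le_trans _ _ (g k y)).
      by rewrite /g indicE mem_set// mule1 lee_fin.
    apply: le_trans (nneseries_lim_ge k.+1 _) => //.
    by rewrite big_nat_recr//= leeDr// sume_ge0.
rewrite integral_nneseries//.
apply: (@le_trans _ _ (\sum_(k <oo) (geometric (c * b) t k)%:E)%E).
  apply: lee_nneseries => [k _ _|k _].
    by apply: integral_ge0.
  rewrite /g ge0_integralZl//; last 2 first.
  - by apply/measurable_EFinP; exact: measurable_indic.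
  - by rewrite lee_fin.
  rewrite integral_indic// setIT.
  apply: (@le_trans _ _ ((a k)%:E * (c * s k `^ N)%:E)%E).
    by apply: lee_wpmul2l; rewrite ?lee_fin//; exact: mu_ball.
  rewrite -EFinM lee_fin /= mulrCA -mulrA.
  by rewrite ler_wpM2l// ltW.
apply: lime_le.
  apply: is_cvg_nneseries => k _ _; rewrite lee_fin.
  by rewrite mulr_ge0 ?mulr_ge0// ?ltW// exprn_gt0.
apply: nearW => n; rewrite sumEFin lee_fin.
apply: (geometric_le_lim n) => //; first by rewrite mulr_ge0// ltW.
by rewrite ger0_norm// ltW.
Qed.


(** The dyadic shells shrink towards x, and the one of radius r 2^-k contributes a multiple of (r
    2^-k)^al, summable because al > 0. *)
Lemma near_integral al : 0 < al < N -> exists2 C, 0 < C & forall x r, 0 < r ->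
  (\int[mu]_y (if D x y < r then (D x y `^ (N - al))^-1 else 0)%:E
     <= (C * r `^ al)%:E)%E.
Proof.
move=> /andP[al0 alN]; have lam0 : 0 < N - al by rewrite subr_gt0.
pose h : R := 2^-1.
have h01 : 0 < h < 1 by rewrite /h; lra.
have /andP[h0 h1] := h01.
have /andP[t0 t1] := powR_lt1 h01 al0.
exists (c * 2 `^ (N - al + N) / (1 - h `^ al)).
  by rewrite !mulr_gt0// ?powR_gt0// invr_gt0 subr_gt0.
move=> x r r0; pose s k : R := r * h ^+ k.
have s0 k : 0 < s k by rewrite mulr_gt0// exprn_gt0.
have mDx := measurable_dist x.
rewrite (_ : c * _ / _ * _ =
  c * (2 `^ (N - al + N) * r `^ al) / (1 - h `^ al)); last by ring.
(* Shell k is s_k / 2 < D x y <= s_k; the radius [2 * s k] makes the open ball contain its outer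
   edge. *)
apply: (@dyadic_integral x _ (fun k => (s k / 2) `^ (- (N - al)))
  (fun k => 2 * s k)) => //.
- apply: measurable_fun_if => //.
    exact: measurable_fun_ltr.
  apply: measurable_funTS; under eq_fun do rewrite -powRN.
  by apply: (measurableT_comp (measurable_powR _)).
- by move=> y; case: ifP => // _; rewrite invr_ge0 powR_ge0.
- by move=> k; rewrite powR_ge0.
- by move=> k; rewrite mulr_gt0.
- by rewrite t0.
- move=> k; rewrite -powRXn ?(ltW h0)//.
  rewrite !powR_expR ?mulr_gt0 ?exprn_gt0// /s.
  rewrite -!expRD !lnM ?posrE ?mulr_gt0 ?exprn_gt0// ler_expR /h !lnV ?posrE//.
  set a := ln r; set b := ln 2; set e := ln (_ ^+ _); lra.
- move=> y; case: ifP => [Dr|_]; last by rewrite eqxx.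
  rewrite -powRN => /eqP F0.
  (* At distance 0 the kernel has the value 0, by the convention for [powR] at 0, so only positive
     distances need a shell. *)
  have D0 : 0 < D x y.
    rewrite lt_neqAle D_ge0 andbT; apply/eqP => D0; apply: F0.
    by rewrite -D0 powR0// oppr_eq0 gt_eqF.
  have [|k /andP[k1 k2]] := @dyadic_ge1 R (r / D x y).
    by rewrite ler_pdivlMr// mul1r ltW.
  exists k.
    rewrite /s /h exprVn mulrA ltr_pdivlMr ?exprn_gt0//.
    move: k1; rewrite ler_pdivlMr// mulrC => k1; apply: le_lt_trans k1 _; lra.
  apply: ler_powRN; rewrite ?(ltW lam0)// ?divr_gt0//.
  rewrite /s /h exprVn -mulrA -invfM -exprSr ler_pdivrMr ?exprn_gt0//.
  by move: k2; rewrite ltr_pdivrMr// mulrC => /ltW.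
Qed.

(** The dyadic shells now grow, and the one at distance r 2^k contributes a multiple of (r 2^k)^(N -
    m), summable because m > N. *)
Lemma far_integral m : N < m -> exists2 C, 0 < C & forall x r, 0 < r ->
  (\int[mu]_y (if D x y < r then 0 else D x y `^ (- m))%:E
     <= (C * r `^ (N - m))%:E)%E.
Proof.
move=> Nm; have m0 : 0 < m by apply: lt_trans Nm.
have h01 : 0 < (2^-1 : R) < 1 by lra.
have /andP[t0 t1] : 0 < 2^-1 `^ (m - N) < (1 : R).
  by rewrite powR_lt1// subr_gt0.
exists (c * 2 `^ N / (1 - 2^-1 `^ (m - N))).
  by rewrite !mulr_gt0// ?powR_gt0// invr_gt0 subr_gt0.
move=> x r r0; pose s k : R := r * 2 ^+ k.
have s0 k : 0 < s k by rewrite mulr_gt0// exprn_gt0.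
have mDx := measurable_dist x.
rewrite (_ : c * _ / _ * _ =
  c * (2 `^ N * r `^ (N - m)) / (1 - 2^-1 `^ (m - N))); last by ring.
apply: (@dyadic_integral x _ (fun k => s k `^ (- m)) (fun k => 2 * s k)) => //.
- apply: measurable_fun_if => //.
    exact: measurable_fun_ltr.
  by apply: measurable_funTS; apply: (measurableT_comp (measurable_powR _)).
- by move=> y; case: ifP => // _; rewrite powR_ge0.
- by move=> k; rewrite powR_ge0.
- by move=> k; rewrite mulr_gt0.
- by rewrite t0.
- move=> k; rewrite -powRXn ?invr_ge0//.
  rewrite !powR_expR ?mulr_gt0 ?exprn_gt0// /s.
  rewrite -!expRD !lnM ?posrE ?mulr_gt0 ?exprn_gt0// ler_expR exprVn.
  rewrite lnV ?posrE ?exprn_gt0//.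
  set a := ln r; set b := ln 2; set e := ln (_ ^+ _); lra.
- move=> y; case: ifP => [|/negbT]; first by rewrite eqxx.
  rewrite -leNgt => rD _; have D0 := lt_le_trans r0 rD.
  have [|k /andP[k1 k2]] := @dyadic_ge1 R (D x y / r).
    by rewrite ler_pdivlMr// mul1r.
  exists k.
    by move: k2; rewrite ltr_pdivrMr// exprS /s -mulrA [r * _]mulrC.
  apply: ler_powRN; rewrite ?(ltW m0)//.
  by move: k1; rewrite ler_pdivlMr// mulrC.
Qed.

(** Near x, [h] is replaced by [H] and the kernel is integrated. Far from x, Young's inequality with
    conjugate exponents t and t' separates h^t from the power t' of the kernel, which is integrable
    at infinity because t al < N. *)
Lemma truncated_potential al t : 0 < al < N -> 1 < t -> t * al < N ->
  exists2 C, 0 < C & forall x (h : T -> R) J H,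
    measurable_fun setT h -> (forall y, 0 <= h y) -> 0 < J -> 0 <= H ->
    (\int[mu]_y (h y `^ t)%:E <= J%:E)%E ->
    (\int[mu]_y (if (h y <= H)%R then h y * (D x y `^ (N - al))^-1 else 0)%:E
       <= (C * J `^ (al / N) * H `^ (1 - t * al / N))%:E)%E.
Proof.
move=> al0N t1 taN; have /andP[al0 alN] := al0N.
have t0 : 0 < t by lra.
have tm0 : 0 < t - 1 by lra.
pose t' := t / (t - 1); have t'0 : 0 < t' by rewrite divr_gt0.
pose m := (N - al) * t'.
have Nm : N < m by rewrite /m /t' mulrA ltr_pdivlMr//; lra.
have [C1 C10 near] := near_integral al0N.
have [C2 C20 far] := far_integral Nm.
exists (C1 + 1 + C2); first by lra.
move=> x h J H mh h0 J0; rewrite le_eqVlt => /predU1P[<- _|H0 hJ].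
  rewrite integral0_eq; last first.
    move=> y _; case: ifPn => // hy; congr (_%:E).
    by apply/eqP; rewrite mulf_eq0 eq_le hy h0.
  by rewrite lee_fin !mulr_ge0 ?powR_ge0//; lra.
(* this radius balances the contributions of near and far points *)
pose r := (J / H `^ t) `^ N^-1.
have r0 : 0 < r by rewrite powR_gt0// divr_gt0// powR_gt0.
(* [g] is the target bound divided by [J]. Young's inequality is applied to k h and K / k with k^t =
   g; with these choices each of the three resulting terms is a constant times the target [P]. *)
pose g := J `^ (al / N - 1) * H `^ (1 - t * al / N).
have g0 : 0 < g by rewrite mulr_gt0// powR_gt0.
pose k := g `^ t^-1; have k0 : 0 < k by rewrite powR_gt0.
have kt : k `^ t = g by rewrite -powRrM mulVf ?gt_eqF// powRr1// ltW.
pose nr y := if D x y < r then (D x y `^ (N - al))^-1 else 0.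
pose fr y := if D x y < r then 0 else D x y `^ (- m).
have mDx := measurable_dist x.
have mKx p : measurable_fun setT (fun y => D x y `^ p).
  by apply: (measurableT_comp (measurable_powR _)).
have mnr : measurable_fun setT nr.
  apply: measurable_fun_if => //; first exact: measurable_fun_ltr.
  by apply: measurable_funTS; under eq_fun do rewrite -powRN; exact: mKx.
have mfr : measurable_fun setT fr.
  apply: measurable_fun_if => //; first exact: measurable_fun_ltr.
  exact: measurable_funTS.
have nr0 y : 0 <= nr y by rewrite /nr; case: ifP; rewrite ?invr_ge0 ?powR_ge0.
have fr0 y : 0 <= fr y by rewrite /fr; case: ifP; rewrite ?powR_ge0.
have mht : measurable_fun setT (fun y => h y `^ t).
  by apply: (measurableT_comp (measurable_powR _)).
pose q := k^-1 `^ t'.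
have q0 : 0 <= q by rewrite powR_ge0.
have m1 : measurable_fun setT (fun y => H * nr y) by exact: measurable_funM.
have m2 : measurable_fun setT (fun y => g * h y `^ t) by exact: measurable_funM.
have m3 : measurable_fun setT (fun y => q * fr y) by exact: measurable_funM.
have m23 := measurable_funD m2 m3.
have p1 y : 0 <= H * nr y by rewrite mulr_ge0// ltW.
have p2 y : 0 <= g * h y `^ t by rewrite mulr_ge0 ?powR_ge0// ltW.
have p3 y : 0 <= q * fr y by rewrite mulr_ge0.
have p23 y : 0 <= g * h y `^ t + q * fr y by rewrite addr_ge0.
apply: (@le_trans _ _
    (\int[mu]_y (H * nr y + (g * h y `^ t + q * fr y))%:E)%E).
  apply: ge0_le_integral_fin.
  - apply: measurable_fun_if => //; first exact: measurable_fun_ler.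
    apply: measurable_funTS; apply: measurable_funM => //.
    by under eq_fun do rewrite -powRN; exact: mKx.
  - move=> y; case: ifP => // _.
    by rewrite mulr_ge0// invr_ge0 powR_ge0.
  - exact: measurable_funD m1 m23.
  - move=> y.
    have gh0 : 0 <= g * h y `^ t by rewrite mulr_ge0 ?powR_ge0// ltW.
    case: ifPn => hH; last first.
      by rewrite !addr_ge0// mulr_ge0// ltW.
    rewrite /nr /fr.
    have K0 : 0 <= (D x y `^ (N - al))^-1 by rewrite invr_ge0 powR_ge0.
    case: ifPn => Dr.
      by rewrite mulr0 addr0 ler_wpDr// ler_wpM2r.
    rewrite mulr0 add0r.
    rewrite (_ : h y * _ = (k * h y) * (k^-1 * (D x y `^ (N - al))^-1)); last first.
      by rewrite mulrACA mulfV ?gt_eqF// mul1r.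
    have := @conjugate_powR R (k * h y) (k^-1 * (D x y `^ (N - al))^-1) t t'.
    rewrite !mulr_ge0 ?invr_ge0 ?powR_ge0 ?(ltW k0)// => /(_ isT isT t0 t'0).
    have -> : t^-1 + t'^-1 = 1 by rewrite /t'; field; rewrite !gt_eqF.
    move=> /(_ erefl) /le_trans; apply.
    rewrite powRM ?(ltW k0)// kt powRM ?invr_ge0 ?powR_ge0 ?(ltW k0)//.
    rewrite -powRN -powRrM mulNr -/m -/q.
    apply: lerD.
      by rewrite ler_pdivrMr// ler_peMr// ltW.
    have fm0 : 0 <= q * D x y `^ (- m) by rewrite mulr_ge0 ?powR_ge0.
    rewrite ler_pdivrMr// ler_peMr//.
    by rewrite /t' ler_pdivlMr//; lra.
rewrite ge0_integralD_fin// ge0_integralD_fin//.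
rewrite !ge0_integralMl_fin ?(ltW H0) ?(ltW g0)//; last by move=> y; exact: powR_ge0.
apply: (@le_trans _ _ (H%:E * (C1 * r `^ al)%:E +
  (g%:E * J%:E + q%:E * (C2 * r `^ (N - m))%:E)))%E.
  apply: leeD; first by apply: lee_wpmul2l; [rewrite lee_fin ltW|exact: near].
  apply: leeD; first by apply: lee_wpmul2l; rewrite ?lee_fin// ltW.
  by apply: lee_wpmul2l; [rewrite lee_fin|exact: far].
rewrite -!EFinM -!EFinD lee_fin.
have lr : ln r = N^-1 * (ln J - t * ln H).
  by rewrite ln_powR ln_div ?posrE ?powR_gt0// ln_powR.
have lg : ln g = (al / N - 1) * ln J + (1 - t * al / N) * ln H.
  by rewrite lnM ?posrE ?powR_gt0// !ln_powR.
have lk : ln k = t^-1 * ln g by rewrite ln_powR.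
set P := J `^ (al / N) * H `^ (1 - t * al / N).
have PE : P = expR (al / N * ln J + (1 - t * al / N) * ln H).
  by rewrite expRD -!powR_expR.
have E1 : H * r `^ al = P.
  rewrite -{1}(lnK (H0 : H \in Num.pos)) (powR_expR _ r0) -expRD PE lr.
  by congr expR; field; rewrite gt_eqF.
have E2 : g * J = P.
  rewrite -{1}(lnK (g0 : g \in Num.pos)) -{1}(lnK (J0 : J \in Num.pos)).
  by rewrite -expRD PE lg; congr expR; ring.
have E3 : q * r `^ (N - m) = P.
  rewrite /q !powR_expR ?invr_gt0// -expRD PE lnV// lk lg lr /m /t'.
  by congr expR; field; rewrite !gt_eqF.
rewrite -mulrA -/P (mulrCA H C1) E1 E2 (mulrCA q C2) E3.
by rewrite !mulrDl mul1r addrA.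
Qed.

(** * The Hardy-Littlewood-Sobolev inequality *)

Lemma measurable_powR_comp (f : T -> R) p :
  measurable_fun setT f -> measurable_fun setT (fun x => f x `^ p).
Proof. exact: (measurableT_comp (measurable_powR _)). Qed.

Lemma measurable_kernel p :
  measurable_fun setT (fun z : T * T => (D z.1 z.2 `^ p)^-1).
Proof.
under eq_fun do rewrite -powRN.
exact: (measurableT_comp (measurable_powR _) mD).
Qed.

(** Testing with h = k^(b - 1) gives h^t = k^b for t conjugate to b, so [J] is at once the integral
    of k h and that of h^t. The two halves of the form yield J <= (C1 + C2) J^(1/t), and finiteness
    of [J] permits division. Assuming only an upper bound on [k] lets the lemma apply to
    truncations. *)
Lemma hls_dual al a b : 0 < al < N -> 1 < a -> 0 < b -> b^-1 = a^-1 - al / N ->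
  exists2 C, 0 < C & forall (f k : T -> R) J,
    measurable_fun setT f -> (forall y, 0 <= f y) ->
    measurable_fun setT k -> (forall y, 0 <= k y) ->
    (forall x, (k x)%:E <=
       \int[mu]_y (f y * (D x y `^ (N - al))^-1)%:E)%E ->
    (\int[mu]_y (f y `^ a)%:E <= 1)%E -> 0 < J ->
    (\int[mu]_x (k x `^ b)%:E = J%:E)%E -> J <= C.
Proof.
move=> al0N a1 b0 bE; have /andP[al0 alN] := al0N.
have a0 : 0 < a by lra.
have al0' : 0 < al / N by rewrite divr_gt0.
have ba : b^-1 < a^-1 by lra.
have b1 : 1 < b.
  by rewrite -invf_lt1//; apply: lt_trans ba _; rewrite invf_lt1.
have bm0 : 0 < b - 1 by lra.
pose t := b / (b - 1); have t0 : 0 < t by rewrite divr_gt0.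
have tV : t^-1 = 1 - b^-1 by rewrite /t; field; rewrite !gt_eqF.
have t1 : 1 < t by rewrite /t ltr_pdivlMr//; lra.
have a1' : a^-1 < 1 by rewrite invf_lt1.
have b0' : 0 < b^-1 by rewrite invr_gt0.
have taN : t * al < N.
  rewrite -ltr_pdivlMl// mulrC -ltr_pdivrMl// mulrC tV; lra.
have aaN : a * al < N.
  rewrite -ltr_pdivlMl// mulrC -ltr_pdivrMl// mulrC; lra.
have [C1 C10 tp1] := truncated_potential al0N t1 taN.
have [C2 C20 tp2] := truncated_potential al0N a1 aaN.
exists ((C1 + C2) `^ b); first by rewrite powR_gt0// addr_gt0.
move=> f k J mf f0 mk k0 kf fA J0 kJ.
pose K x y := (D x y `^ (N - al))^-1.
have K0 x y : 0 <= K x y by rewrite invr_ge0 powR_ge0.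
(* Both thresholds compare f(y)^a with h(x)^t / J, where h^t = k^b. Hence at every pair (x, y) at
   least one of the two conditions holds. *)
pose H1 y := (J * f y `^ a) `^ t^-1.
pose H2 x := (k x `^ b / J) `^ a^-1.
pose h x := k x `^ (b - 1).
have h0 x : 0 <= h x by exact: powR_ge0.
have mh : measurable_fun setT h by exact: measurable_powR_comp.
have mH1 : measurable_fun setT H1.
  by apply: measurable_powR_comp; apply: measurable_funM => //;
    exact: measurable_powR_comp.
have mH2 : measurable_fun setT H2.
  by apply: measurable_powR_comp; apply: measurable_funM => //;
    exact: measurable_powR_comp.
pose G x y := h x * f y * K x y.
have G0 x y : 0 <= G x y by rewrite !mulr_ge0.
pose G1 (z : T * T) := if h z.1 <= H1 z.2 then G z.1 z.2 else 0.
pose G2 (z : T * T) := if f z.2 <= H2 z.1 then G z.1 z.2 else 0.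
have G10 z : 0 <= G1 z by rewrite /G1; case: ifP.
have G20 z : 0 <= G2 z by rewrite /G2; case: ifP.
have m1 (u : T -> R) : measurable_fun setT u ->
    measurable_fun setT (fun z : T * T => u z.1).
  by move=> mu'; exact: (measurableT_comp mu' measurable_fst).
have m2 (u : T -> R) : measurable_fun setT u ->
    measurable_fun setT (fun z : T * T => u z.2).
  by move=> mu'; exact: (measurableT_comp mu' measurable_snd).
have mG : measurable_fun setT (fun z : T * T => G z.1 z.2).
  apply: measurable_funM; last exact: measurable_kernel.
  by apply: measurable_funM; [exact: m1|exact: m2].
have mG1 : measurable_fun setT G1.
  apply: measurable_fun_ifT => //.
  by apply: measurable_fun_ler; [exact: m1|exact: m2].
have mG2 : measurable_fun setT G2.
  apply: measurable_fun_ifT => //.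
  by apply: measurable_fun_ler; [exact: m2|exact: m1].
have cover x y : G x y <= G1 (x, y) + G2 (x, y).
  rewrite /G1 /G2 /=; case: ifPn => [_|nh]; first by rewrite lerDl; case: ifP.
  rewrite ifT ?add0r//; move: nh; rewrite -ltNge => nh.
  suff : f y `^ a <= k x `^ b / J.
    move=> /(ge0_ler_powR (_ : 0 <= a^-1)).
    rewrite !nnegrE powR_ge0 divr_ge0 ?powR_ge0 ?(ltW J0)// => /(_ _ isT isT).
    rewrite -powRrM mulfV ?gt_eqF// powRr1//; apply.
    by rewrite invr_ge0 ltW.
  rewrite ler_pdivlMr// mulrC leNgt; apply/negP => kJf.
  move: nh; apply/negP; rewrite -leNgt.
  have -> : h x = (k x `^ b) `^ t^-1.
    by rewrite -powRrM /h; congr (_ `^ _); rewrite /t; field; rewrite !gt_eqF.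
  apply: ge0_ler_powR; rewrite ?nnegrE ?powR_ge0 ?mulr_ge0 ?powR_ge0//.
  - by rewrite invr_ge0 ltW.
  - exact: ltW.
  - exact: ltW.
(* For fixed y the truncated potential of h at level H1(y) is a power of f(y); the relation between
   a and b makes it f(y)^(a - 1), and the factor f(y) completes it to f(y)^a. *)
have I1 y : (\int[mu]_x (G1 (x, y))%:E <=
    (C1 * J `^ t^-1)%:E * (f y `^ a)%:E)%E.
  have /= := tp1 y h J (H1 y) mh h0 J0 (powR_ge0 _ _) _.
  rewrite /h; under eq_integral do rewrite -powRrM.
  rewrite (_ : (b - 1) * t = b); last by rewrite /t; field; rewrite gt_eqF.
  rewrite kJ lexx => /(_ isT) tp.
  have -> : (fun x => (G1 (x, y))%:E) = (fun x => (f y)%:E *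
     (if h x <= H1 y then h x * (D y x `^ (N - al))^-1 else 0)%:E)%E.
    apply/funext => x; rewrite -EFinM /G1 /=; congr (_%:E).
    case: ifP; rewrite ?mulr0// => _.
    by rewrite /G /K (D_sym y x) mulrA [f y * _]mulrC.
  rewrite ge0_integralZl//; last 3 first.
  - apply/measurable_EFinP/measurable_fun_ifT => //.
      exact: (measurable_fun_ler mh (measurable_cst (H1 y))).
    apply: measurable_funM => //.
    exact: (measurableT_comp (measurable_kernel _) (measurable_pair1 y)).
  - move=> x _; rewrite lee_fin; case: ifP => // _.
    by rewrite mulr_ge0// invr_ge0 powR_ge0.
  - by rewrite lee_fin.
  apply: (@le_trans _ _ ((f y)%:E *
     (C1 * J `^ (al / N) * H1 y `^ (1 - t * al / N))%:E)%E).
    by apply: lee_wpmul2l => //; rewrite lee_fin.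
  rewrite -!EFinM lee_fin /H1 -powRrM powRM ?powR_ge0 ?(ltW J0)//.
  rewrite -powRrM.
  have -> : a * (t^-1 * (1 - t * al / N)) = a - 1.
    rewrite mulrBr mulr1 mulrA mulrA mulVf ?gt_eqF// mul1r tV bE.
    by field; rewrite !gt_eqF.
  rewrite (_ : f y * _ = f y * (C1 * (J `^ (al / N) *
    J `^ (t^-1 * (1 - t * al / N)) * f y `^ (a - 1)))); last by ring.
  rewrite -powRD; last by rewrite (gt_eqF J0) implybT.
  have -> : al / N + t^-1 * (1 - t * al / N) = t^-1.
    by field; rewrite !gt_eqF.
  by rewrite mulrCA (mulrCA (f y)) mulr_powRB1// mulrA.
have I2 x : (\int[mu]_y (G2 (x, y))%:E <=
    (C2 * J `^ (- b^-1))%:E * (k x `^ b)%:E)%E.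
  have := tp2 x f 1 (H2 x) mf f0 ltr01 (powR_ge0 _ _) fA.
  rewrite powR1 mulr1 => tp.
  have -> : (fun y => (G2 (x, y))%:E) = (fun y => (h x)%:E *
     (if f y <= H2 x then f y * (D x y `^ (N - al))^-1 else 0)%:E)%E.
    apply/funext => y; rewrite -EFinM /G2 /=; congr (_%:E).
    case: ifP; rewrite ?mulr0// => _.
    by rewrite /G /K mulrA.
  rewrite ge0_integralZl//; last 3 first.
  - apply/measurable_EFinP/measurable_fun_ifT => //.
      exact: (measurable_fun_ler mf (measurable_cst (H2 x))).
    apply: measurable_funM => //.
    exact: (measurableT_comp (measurable_kernel _) (measurable_pair1 x)).
  - move=> y _; rewrite lee_fin; case: ifP => // _.
    by rewrite mulr_ge0// invr_ge0 powR_ge0.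
  - by rewrite lee_fin.
  apply: (@le_trans _ _ ((h x)%:E * (C2 * H2 x `^ (1 - a * al / N))%:E)%E).
    by apply: lee_wpmul2l => //; rewrite lee_fin.
  rewrite -!EFinM lee_fin /H2 -powRrM powRM ?powR_ge0 ?invr_ge0 ?(ltW J0)//.
  have -> : a^-1 * (1 - a * al / N) = b^-1.
    by rewrite bE; field; rewrite !gt_eqF.
  rewrite -powRrM mulfV ?gt_eqF// powRr1// -powR_inv1 ?(ltW J0)// -powRrM mulN1r.
  rewrite /h -(mulr_powRB1 (k0 x) b0).
  by rewrite le_eqVlt; apply/orP; left; apply/eqP; ring.
(* By Tonelli, [G1] is integrated first in x and [G2] first in y. Both cost a multiple of J^(1/t):
   the first because the integral of f^a is at most 1, the second because J^(-1/b) J = J^(1/t). *)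
have JE : (J%:E <= ((C1 + C2) * J `^ t^-1)%:E)%E.
  rewrite -kJ.
  apply: (@le_trans _ _ (\int[mu]_x \int[mu]_y ((G1 (x, y))%:E + (G2 (x, y))%:E))%E).
    apply: ge0_le_integral => //.
    - by move=> x _; rewrite lee_fin powR_ge0.
    - by apply/measurable_EFinP; exact: measurable_powR_comp.
    - apply: (measurable_fun_fubini_tonelli_F
        (fun z => (G1 z)%:E + (G2 z)%:E)%E).
      + by apply: emeasurable_funD; apply/measurable_EFinP.
      + by move=> z; rewrite adde_ge0 ?lee_fin.
    - move=> x _; rewrite -(mulr_powRB1 (k0 x) b0) mulrC EFinM -/(h x).
      apply: (@le_trans _ _ ((h x)%:E *
          \int[mu]_y (f y * (D x y `^ (N - al))^-1)%:E)%E).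
        by apply: lee_wpmul2l; rewrite ?lee_fin.
      have mfK : measurable_fun setT (fun y => f y * (D x y `^ (N - al))^-1).
        apply: measurable_funM => //.
        exact: (measurableT_comp (measurable_kernel _) (measurable_pair1 x)).
      rewrite -ge0_integralZl//; last 3 first.
      + exact/measurable_EFinP.
      + by move=> y _; rewrite lee_fin mulr_ge0// K0.
      + by rewrite lee_fin.
      apply: ge0_le_integral => //.
      + by move=> y _; rewrite -EFinM lee_fin !mulr_ge0// K0.
      + by apply: emeasurable_funM => //; exact/measurable_EFinP.
      + apply: emeasurable_funD; apply/measurable_EFinP.
          exact: (measurableT_comp mG1 (measurable_pair1 x)).
        exact: (measurableT_comp mG2 (measurable_pair1 x)).
      + move=> y _; rewrite -EFinM -EFinD lee_fin.
        by apply: le_trans (cover x y); rewrite /G /K mulrA.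
  under eq_integral => x _.
    rewrite ge0_integralD//; last 4 first.
    - by move=> y _; rewrite lee_fin.
    - by apply/measurable_EFinP; exact: (measurableT_comp mG1 (measurable_pair1 x)).
    - by move=> y _; rewrite lee_fin.
    - by apply/measurable_EFinP; exact: (measurableT_comp mG2 (measurable_pair1 x)).
    over.
  have mFG (F : T * T -> R) : measurable_fun setT F -> (forall z, 0 <= F z) ->
      measurable_fun setT (fun x => \int[mu]_y (F (x, y))%:E)%E.
    move=> mF F0; apply: (measurable_fun_fubini_tonelli_F (EFin \o F)).
      exact/measurable_EFinP.
    by move=> z; rewrite /= lee_fin.
  rewrite ge0_integralD//; last 4 first.
  - by move=> x _; apply: integral_ge0 => y _; rewrite lee_fin.
  - exact: mFG.
  - by move=> x _; apply: integral_ge0 => y _; rewrite lee_fin.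
  - exact: mFG.
  rewrite mulrDl EFinD; apply: leeD.
  - rewrite (fubini_tonelli (EFin \o G1))/=; first last.
    + by move=> z; rewrite /= lee_fin.
    + exact/measurable_EFinP.
    apply: (@le_trans _ _ (\int[mu]_y ((C1 * J `^ t^-1)%:E * (f y `^ a)%:E))%E).
      apply: ge0_le_integral => //.
      + by move=> y _; apply: integral_ge0 => x _; rewrite lee_fin.
      + apply: (measurable_fun_fubini_tonelli_G (EFin \o G1)).
          exact/measurable_EFinP.
        by move=> z; rewrite /= lee_fin.
      + apply: emeasurable_funM => //; apply/measurable_EFinP.
        exact: measurable_powR_comp.
    rewrite ge0_integralZl//; last 3 first.
    + by apply/measurable_EFinP; exact: measurable_powR_comp.
    + by move=> y _; rewrite lee_fin powR_ge0.
    + by rewrite lee_fin mulr_ge0 ?powR_ge0// ltW.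
    rewrite -[leRHS]mule1; apply: lee_wpmul2l => //.
    by rewrite lee_fin mulr_ge0 ?powR_ge0// ltW.
  - apply: (@le_trans _ _ (\int[mu]_x ((C2 * J `^ (- b^-1))%:E * (k x `^ b)%:E))%E).
      apply: ge0_le_integral => //.
      + by move=> y _; apply: integral_ge0 => x _; rewrite lee_fin.
      + exact: mFG.
      + apply: emeasurable_funM => //; apply/measurable_EFinP.
        exact: measurable_powR_comp.
    rewrite ge0_integralZl//; last 3 first.
    + by apply/measurable_EFinP; exact: measurable_powR_comp.
    + by move=> y _; rewrite lee_fin powR_ge0.
    + by rewrite lee_fin mulr_ge0 ?powR_ge0// ltW.
    rewrite kJ -EFinM lee_fin -mulrA ler_wpM2l ?(ltW C20)//.
    rewrite -{2}[J]powRr1 ?(ltW J0)// -powRD; last by rewrite (gt_eqF J0) implybT.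
    by rewrite tV addrC.
move: JE; rewrite lee_fin => JE.
have {}JE : J `^ b^-1 <= C1 + C2.
  rewrite -(@ler_pM2r _ (J `^ t^-1)) ?powR_gt0// -powRD; last first.
    by rewrite (gt_eqF J0) implybT.
  by rewrite (_ : b^-1 + t^-1 = 1) ?powRr1 ?(ltW J0)// tV addrC subrK.
have := @ge0_ler_powR R b (ltW b0) _ _ _ _ JE.
rewrite -powRrM mulVf ?gt_eqF// powRr1 ?(ltW J0)//; apply.
  by rewrite nnegrE powR_ge0.
by rewrite nnegrE addr_ge0// ltW.
Qed.

(** Scaling by A^(-1/a) reaches the normalised case. The finite integral required by [hls_dual]
    comes from truncating [g] in height and to balls about [point]; monotone convergence removes the
    truncation. *)
Lemma hls al a b : 0 < al < N -> 1 < a -> 0 < b -> b^-1 = a^-1 - al / N ->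
  exists2 C, 0 < C & forall (f g : T -> R) A, 0 < A ->
    measurable_fun setT f -> (forall y, 0 <= f y) ->
    measurable_fun setT g -> (forall y, 0 <= g y) ->
    (forall x, (g x)%:E <=
       \int[mu]_y (f y * (D x y `^ (N - al))^-1)%:E)%E ->
    (\int[mu]_y (f y `^ a)%:E <= A%:E)%E ->
    (\int[mu]_x (g x `^ b)%:E <= (C * A `^ (b / a))%:E)%E.
Proof.
move=> al0N a1 b0 bE; have a0 : 0 < a by lra.
have [C C0 dual] := hls_dual al0N a1 b0 bE.
exists C => // f g A A0 mf f0 mg g0 gf fA.
pose s := A `^ a^-1; have s0 : 0 < s by rewrite powR_gt0.
have sV0 : 0 <= s^-1 by rewrite invr_ge0 ltW.
have sa : s `^ a = A by rewrite -powRrM mulVf ?gt_eqF// powRr1// ltW.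
pose f' y := s^-1 * f y; pose g' y := s^-1 * g y.
have mf' : measurable_fun setT f' by exact: measurable_funM.
have mg' : measurable_fun setT g' by exact: measurable_funM.
have f'0 y : 0 <= f' y by rewrite mulr_ge0.
have g'0 y : 0 <= g' y by rewrite mulr_ge0.
have mK x : measurable_fun setT (fun y => (D x y `^ (N - al))^-1).
  exact: (measurableT_comp (measurable_kernel _) (measurable_pair1 x)).
have g'f' x : ((g' x)%:E <=
    \int[mu]_y (f' y * (D x y `^ (N - al))^-1)%:E)%E.
  under eq_integral => y _ do rewrite /f' -mulrA EFinM.
  rewrite ge0_integralZl ?lee_fin//; last 2 first.
  - by apply/measurable_EFinP; exact: measurable_funM.
  - by move=> y _; rewrite lee_fin mulr_ge0// invr_ge0 powR_ge0.
  by rewrite EFinM; apply: lee_wpmul2l; rewrite ?lee_fin.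
have f'1 : (\int[mu]_y (f' y `^ a)%:E <= 1)%E.
  under eq_integral => y _ do rewrite /f' powRM// EFinM.
  rewrite ge0_integralZl ?lee_fin ?powR_ge0//; last 2 first.
  - by apply/measurable_EFinP; exact: measurable_powR_comp.
  - by move=> y _; rewrite lee_fin powR_ge0.
  apply: (@le_trans _ _ ((s^-1 `^ a)%:E * A%:E)%E).
    by apply: lee_wpmul2l => //; rewrite lee_fin powR_ge0.
  by rewrite -sa -EFinM -powRM ?(ltW s0)// mulVf ?gt_eqF// powR1.
pose k (n : nat) x := if D point x < n%:R then Num.min (g' x) n%:R else 0.
have k0 n x : 0 <= k n x by rewrite /k; case: ifP; rewrite // le_min g'0 ler0n.
have mD' := measurable_dist point.
have mk n : measurable_fun setT (k n).
  apply: measurable_fun_ifT => //.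
    exact: (measurable_fun_ltr mD' (measurable_cst _)).
  exact: (measurable_minr mg' (measurable_cst _)).
have mkb n : measurable_fun setT (fun x => k n x `^ b).
  exact: measurable_powR_comp.
have kg n x : k n x <= g' x.
  by rewrite /k; case: ifP; rewrite // ge_min lexx.
have kC n : (\int[mu]_x (k n x `^ b)%:E <= C%:E)%E.
  have Ige0 : (0 <= \int[mu]_x (k n x `^ b)%:E)%E.
    by apply: integral_ge0 => x _; rewrite lee_fin powR_ge0.
  have Ifin : (\int[mu]_x (k n x `^ b)%:E < +oo)%E.
    have [->|n0] := posnP n.
      rewrite integral0_eq// => x _.
      by rewrite /k ltNge D_ge0/= powR0 ?gt_eqF.
    have n0' : 0 < n%:R :> R by rewrite ltr0n.
    have mB := measurable_dball point n%:R.
    pose B : set T := [set y | (D point y < n%:R)%R].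
    apply: (@le_lt_trans _ _ (\int[mu]_x ((n%:R `^ b)%:E * (\1_B x)%:E))%E).
      apply: ge0_le_integral => //.
      - by move=> x _; rewrite lee_fin powR_ge0.
      - exact/measurable_EFinP.
      - apply: emeasurable_funM => //; apply/measurable_EFinP.
        exact: measurable_indic.
      - move=> x _; rewrite -EFinM lee_fin indicE /k.
        case: ifPn => [xB|xB].
          rewrite mem_set// mulr1; apply: ge0_ler_powR; rewrite ?nnegrE.
          + exact: ltW.
          + by rewrite le_min g'0 ler0n.
          + exact: ler0n.
          + by rewrite ge_min lexx orbT.
        by rewrite powR0 ?gt_eqF// mulr_ge0 ?powR_ge0.
    rewrite ge0_integralZl//; last first.
      by apply/measurable_EFinP; exact: measurable_indic.
    rewrite integral_indic// setIT.
    apply: (@le_lt_trans _ _ ((n%:R `^ b)%:E * (c * n%:R `^ N)%:E)%E).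
      by apply: lee_wpmul2l; [rewrite lee_fin powR_ge0|exact: mu_ball].
    by rewrite -EFinM ltry.
  have JE : (\int[mu]_x (k n x `^ b)%:E =
      (fine (\int[mu]_x (k n x `^ b)%:E))%:E)%E.
    by rewrite fineK// ge0_fin_numE.
  move: Ige0; rewrite JE !lee_fin le_eqVlt => /predU1P[<-|J0]; first exact: ltW.
  apply: (dual f' (k n)) => // x.
  by apply: le_trans (g'f' x); rewrite lee_fin.
have g'C : (\int[mu]_x (g' x `^ b)%:E <= C%:E)%E.
  apply: (@integral_le_lim _ _ _ _ (fun n x => k n x `^ b)) => //.
  - by move=> n x; rewrite powR_ge0.
  - move=> x n m nm; apply: ge0_ler_powR; rewrite ?nnegrE ?(ltW b0)//.
    have nm' : n%:R <= m%:R :> R by rewrite ler_nat.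
    rewrite /k; case: ifPn => [xn|_].
      rewrite (lt_le_trans xn)// le_min !ge_min lexx/=.
      by rewrite nm' orbT.
    by case: ifP; rewrite // le_min g'0 ler0n.
  - move=> x; near=> n.
    have nD : D point x < n%:R by near: n; exact: nbhs_infty_gtr.
    have ng : g' x < n%:R by near: n; exact: nbhs_infty_gtr.
    by rewrite /k nD min_l// ltW.
have -> : (fun x => (g x `^ b)%:E) = (fun x => (s `^ b)%:E * (g' x `^ b)%:E)%E.
  apply/funext => x; rewrite -EFinM -powRM ?(ltW s0)//; congr ((_ `^ _)%:E).
  by rewrite /g' mulrA mulfV ?gt_eqF// mul1r.
rewrite ge0_integralZl//; last 3 first.
- by apply/measurable_EFinP; exact: measurable_powR_comp.
- by move=> x _; rewrite lee_fin powR_ge0.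
- by rewrite lee_fin powR_ge0.
rewrite mulrC EFinM; apply: (@le_trans _ _ ((s `^ b)%:E * C%:E)%E).
  by apply: lee_wpmul2l => //; rewrite lee_fin powR_ge0.
by rewrite /s -powRrM [a^-1 * b]mulrC.
Unshelve. all: by end_near. Qed.

(** * The composed potential and its contraction estimate *)

Variables (al q : R).
Hypothesis al0N : 0 < al < N.
Hypothesis q_gt0 : 0 < q.
Hypothesis qV_le : q^-1 <= 1 - al / N.

Local Notation potential f x :=
  (\int[mu]_y (f y * (D x y `^ (N - al))^-1)%:E)%E.

(** Hardy-Littlewood-Sobolev applied twice: z in L^a gives V in L^s, hence V^q in L^(s/q), hence G
    in L^r; the formula for 1/a is this chain read backwards. Both source exponents exceed 1:
    1/(s/q) = 1/r + al/N < 1, and then 1/s < 1/q <= 1 - al/N gives 1/a < 1. *)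
Lemma two_potentials a r : 0 < r -> r^-1 < 1 - al / N -> 0 < a ->
  a^-1 = al / N + (r^-1 + al / N) / q ->
  exists2 C, 0 < C & forall (z V G : T -> R) A, 0 < A ->
    measurable_fun setT z -> (forall y, 0 <= z y) ->
    measurable_fun setT V -> (forall y, 0 <= V y) ->
    measurable_fun setT G -> (forall y, 0 <= G y) ->
    (forall x, (V x)%:E <= potential z x)%E ->
    (forall x, (G x)%:E <= potential (fun y => V y `^ q) x)%E ->
    (\int[mu]_y (z y `^ a)%:E <= A%:E)%E ->
    (\int[mu]_x (G x `^ r)%:E <= (C * A `^ (r * q / a))%:E)%E.
Proof.
move=> r0 r1 a0 aE; have /andP[al0 alN] := al0N.
have be0 : 0 < al / N by rewrite divr_gt0.
have rV0 : 0 < r^-1 by rewrite invr_gt0.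
have qV0 : 0 < q^-1 by rewrite invr_gt0.
pose s := q / (r^-1 + al / N); have s0 : 0 < s by rewrite divr_gt0// addr_gt0.
have sV : s^-1 = (r^-1 + al / N) / q by rewrite /s invf_div.
have sV1 : s^-1 < 1 - al / N.
  by apply: lt_le_trans qV_le; rewrite sV ltr_pdivrMr// mulVf ?gt_eqF//; lra.
have a1 : 1 < a by rewrite -invf_lt1// aE -sV; lra.
have sE : s^-1 = a^-1 - al / N by rewrite aE sV; lra.
have b0 : 0 < s / q by rewrite divr_gt0.
have bV : (s / q)^-1 = r^-1 + al / N.
  by rewrite invf_div /s invf_div mulrCA mulfV ?gt_eqF// mulr1.
have b1 : 1 < s / q by rewrite -invf_lt1// bV; lra.
have rE : r^-1 = (s / q)^-1 - al / N by rewrite bV; lra.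
have [C1 C10 hls1] := hls al0N a1 s0 sE.
have [C2 C20 hls2] := hls al0N b1 r0 rE.
exists (C2 * C1 `^ (r / (s / q))); first by rewrite mulr_gt0// powR_gt0.
move=> z V G A A0 mz z0 mV V0 mG G0 Vz GV zA.
have VA := hls1 z V A A0 mz z0 mV V0 Vz zA.
have A'0 : 0 < C1 * A `^ (s / a) by rewrite mulr_gt0// powR_gt0.
have := hls2 (fun y => V y `^ q) G _ A'0 (measurable_powR_comp q mV)
  (fun y => powR_ge0 _ _) mG G0 GV.
have -> : (fun y => ((V y `^ q) `^ (s / q))%:E) = (fun y => (V y `^ s)%:E).
  apply/funext => y; rewrite -powRrM; congr ((_ `^ _)%:E).
  by field; rewrite gt_eqF.
move=> /(_ VA) /le_trans; apply.
rewrite lee_fin powRM ?powR_ge0 ?(ltW C10)// mulrA -powRrM.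
rewrite (_ : s / a * (r / (s / q)) = r * q / a)//.
by field; rewrite !gt_eqF.
Qed.

Variables (p r0 : R) (u v : T -> R).
Hypothesis r0_gt0 : 0 < r0.
Hypothesis r0V_lt : r0^-1 < 1 - al / N.
Hypothesis r0E : (p - q^-1) / r0 = al / N * (1 + q^-1).
Hypothesis u_meas : measurable_fun setT u.
Hypothesis v_meas : measurable_fun setT v.
Hypothesis u_gt0 : forall x, 0 < u x.
Hypothesis v_gt0 : forall x, 0 < v x.
Hypothesis uE : forall x, (u x)%:E = potential (fun y => v y `^ q) x.
Hypothesis vE : forall x, (v x)%:E = potential (fun y => u y `^ p) x.
Hypothesis u_r0 : (\int[mu]_x (u x `^ r0)%:E < +oo)%E.

(* [t] is the Hölder weight of the small factor [u ^ (p - 1/q)] on [A]; the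
   estimate is homogeneous of degree one in [M]. *)
Lemma gain r : 0 < r -> r^-1 < 1 - al / N ->
  exists a t e, [/\ 0 < a, 0 < t < 1, 0 < e &
    forall (A : T -> bool) (F y V G : T -> R) M, 0 < M ->
    measurable_fun setT A ->
    measurable_fun setT F -> (forall x, 0 <= F x) ->
    measurable_fun setT y -> (forall x, 0 <= y x) ->
    measurable_fun setT V -> (forall x, 0 <= V x) ->
    measurable_fun setT G -> (forall x, 0 <= G x) ->
    (forall x, (V x)%:E <= potential (fun x => if A x then
        4 * (u x `^ (p - q^-1) * F x `^ q^-1) else 4 * y x) x)%E ->
    (forall x, (G x)%:E <= potential (fun y => V y `^ q) x)%E ->
    (\int[mu]_x (if A x then u x `^ r0 else 0)%:E <= e%:E)%E ->
    (\int[mu]_x (F x `^ r)%:E <= M%:E)%E ->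
    (\int[mu]_x (y x `^ a)%:E <= (e `^ t * M `^ (1 - t))%:E)%E ->
    (\int[mu]_x (G x `^ r)%:E <= (M / 2)%:E)%E].
Proof.
move=> r_gt0 rV_lt; have /andP[al0 alN] := al0N.
have be0 : 0 < al / N by rewrite divr_gt0.
have qV0 : 0 < q^-1 by rewrite invr_gt0.
have rV0 : 0 < r^-1 by rewrite invr_gt0.
pose a := (al / N + (r^-1 + al / N) / q)^-1.
have aV : a^-1 = al / N + (r^-1 + al / N) / q by rewrite invrK.
have a0 : 0 < a.
  by rewrite invr_gt0 addr_gt0// mulr_gt0// addr_gt0.
(* With the relation [r0E], 1 - t = a / (q r); therefore (u^(p - 1/q) F^(1/q))^a is exactly (u^r0)^t
   (F^r)^(1 - t). *)
pose t := a * ((p - q^-1) / r0).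
have t1E : 1 - t = a / (q * r).
  apply/esym/eqP; rewrite -subr_eq opprK /t r0E; apply/eqP.
  rewrite -[RHS](@mulfV _ a) ?gt_eqF// aV; field; rewrite !gt_eqF//.
have t0 : 0 < t.
  by rewrite mulr_gt0// r0E mulr_gt0// addr_gt0.
have t1 : 0 < 1 - t by rewrite t1E divr_gt0// mulr_gt0.
have [C C0 tp] := two_potentials r_gt0 rV_lt a0 aV.
pose k := r * q / a; have k0 : 0 < k by rewrite divr_gt0// mulr_gt0.
have kt : (1 - t) * k = 1 by rewrite t1E /k; field; rewrite !gt_eqF.
pose B := C * (3 * 4 `^ a) `^ k.
have B0 : 0 < B by rewrite mulr_gt0// powR_gt0// mulr_gt0// powR_gt0.
(* [e] makes the final factor B e^(t k) equal to 1/2; the power of M is (1 - t) k = 1. *)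
have [e e0 etk] : exists2 e : R, 0 < e & e `^ (t * k) = (2 * B)^-1.
  have tk0 : t * k != 0 by rewrite mulf_neq0// gt_eqF.
  exists ((2 * B)^-1 `^ (t * k)^-1).
    by rewrite powR_gt0// invr_gt0 mulr_gt0.
  by rewrite -powRrM (mulVf tk0) powRr1// invr_ge0 mulr_ge0// ltW.
exists a, t, e; split => //; first by rewrite t0 -subr_gt0.
move=> A F y V G M M0 mA mF F0 my y0 mV V0 mG G0 Vz GV Ae FM yQ.
pose z x := if A x then 4 * (u x `^ (p - q^-1) * F x `^ q^-1) else 4 * y x.
have u0 x : 0 <= u x by exact: ltW.
have z0 x : 0 <= z x.
  by rewrite /z; case: ifP; rewrite !mulr_ge0 ?powR_ge0.
have mz : measurable_fun setT z.
  apply: measurable_fun_ifT => //; last exact: measurable_funM.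
  apply: measurable_funM => //; apply: measurable_funM; exact: measurable_powR_comp.
pose L := e `^ t * M `^ (1 - t).
have L0 : 0 < L by apply: mulr_gt0; exact: powR_gt0.
pose X x := if A x then u x `^ r0 else 0.
have X0 x : 0 <= X x by rewrite /X; case: ifP; rewrite ?powR_ge0.
have mX : measurable_fun setT X.
  by apply: measurable_fun_ifT => //; exact: measurable_powR_comp.
have mFr : measurable_fun setT (fun x => F x `^ r) by exact: measurable_powR_comp.
have mya : measurable_fun setT (fun x => y x `^ a) by exact: measurable_powR_comp.
(* On [A], the weighted inequality is applied to u^r0 / e and F^r / M, whose integrals over [A] are
   at most 1, so that each of the three terms integrates to at most [L]. *)
have zle x : z x `^ a <= 4 `^ a * (L / e * X x + (L / M * F x `^ r + y x `^ a)).
  have L1 : 0 <= L / e by rewrite divr_ge0 ?ltW.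
  have L2 : 0 <= L / M by rewrite divr_ge0 ?ltW.
  rewrite /z /X; case: ifPn => Ax; last first.
    rewrite powRM// ler_wpM2l ?powR_ge0// mulr0 add0r lerDr.
    by rewrite mulr_ge0// powR_ge0.
  rewrite powRM ?mulr_ge0 ?powR_ge0// ler_wpM2l ?powR_ge0//.
  rewrite addrA (le_trans _ (_ : L / e * u x `^ r0 + L / M * F x `^ r <= _))//;
    last first.
    by rewrite lerDl powR_ge0.
  have := @powR_AMGM R (u x `^ r0 / e) (F x `^ r / M) t.
  rewrite !divr_ge0 ?powR_ge0 ?(ltW e0) ?(ltW M0)// => /(_ isT isT).
  rewrite (ltW t0) -subr_ge0 (ltW t1) => /(_ isT).
  rewrite -(ler_pM2l L0) mulrDr => /le_trans.
  rewrite (_ : L / e * _ = L * (u x `^ r0 / e)); last by rewrite mulrAC -mulrA.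
  rewrite (_ : L / M * _ = L * (F x `^ r / M)); last by rewrite mulrAC -mulrA.
  move/(_ _ (lexx _)); apply: le_trans.
  rewrite !powRM ?powR_ge0 ?invr_ge0 ?(ltW e0) ?(ltW M0)//.
  rewrite -(powR_inv1 (ltW e0)) -(powR_inv1 (ltW M0)) -!powRrM /L.
  have -> : (p - q^-1) * a = r0 * t by rewrite /t; field; rewrite !gt_eqF.
  have -> : q^-1 * a = r * (1 - t) by rewrite t1E; field; rewrite !gt_eqF.
  have cancel (b w : R) : 0 < b -> b `^ w * b `^ (-1 * w) = 1.
    by move=> b0; rewrite mulN1r powRN mulfV// gt_eqF// powR_gt0.
  rewrite le_eqVlt; apply/orP; left; apply/eqP.
  transitivity ((e `^ t * e `^ (-1 * t)) * (M `^ (1 - t) * M `^ (-1 * (1 - t))) *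
    (u x `^ (r0 * t) * F x `^ (r * (1 - t)))); last by ring.
  by rewrite !cancel// !mul1r.
have zL : (\int[mu]_x (z x `^ a)%:E <= (4 `^ a * (3 * L))%:E)%E.
  have Le0 : 0 <= L / e by rewrite divr_ge0 ?ltW.
  have LM0 : 0 <= L / M by rewrite divr_ge0 ?ltW.
  have m1 : measurable_fun setT (fun x => L / e * X x) by exact: measurable_funM.
  have m2 : measurable_fun setT (fun x => L / M * F x `^ r).
    exact: measurable_funM.
  have m3 := measurable_funD m2 mya.
  have P1 x : 0 <= L / e * X x by exact: mulr_ge0.
  have P2 x : 0 <= L / M * F x `^ r by apply: mulr_ge0 => //; exact: powR_ge0.
  have P3 x : 0 <= L / M * F x `^ r + y x `^ a.
    by apply: addr_ge0 => //; exact: powR_ge0.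
  have P4 x : 0 <= L / e * X x + (L / M * F x `^ r + y x `^ a) by exact: addr_ge0.
  apply: (@le_trans _ _ (\int[mu]_x (4 `^ a *
      (L / e * X x + (L / M * F x `^ r + y x `^ a)))%:E)%E).
    apply: ge0_le_integral_fin => //.
    - exact: measurable_powR_comp.
    - by move=> x; exact: powR_ge0.
    - by apply: measurable_funM => //; exact: measurable_funD m1 m3.
  rewrite ge0_integralMl_fin ?powR_ge0//; last exact: measurable_funD m1 m3.
  rewrite EFinM; apply: lee_wpmul2l; first by rewrite lee_fin powR_ge0.
  rewrite ge0_integralD_fin// ge0_integralD_fin//; last by move=> x; exact: powR_ge0.
  rewrite !ge0_integralMl_fin//; last by move=> x; exact: powR_ge0.
  apply: (@le_trans _ _ ((L / e)%:E * e%:E + ((L / M)%:E * M%:E + L%:E))%E).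
    apply: leeD; first by apply: lee_wpmul2l; rewrite ?lee_fin.
    by apply: leeD => //; apply: lee_wpmul2l; rewrite ?lee_fin.
  by rewrite -!EFinM !divfK ?gt_eqF// lee_fin; lra.
have Z0 : 0 < 4 `^ a * (3 * L) by rewrite mulr_gt0 ?powR_gt0// mulr_gt0.
apply: (le_trans (tp z V G _ Z0 mz z0 mV V0 mG G0 Vz GV zL)).
rewrite lee_fin -/k.
have -> : 4 `^ a * (3 * L) = 3 * 4 `^ a * L by ring.
rewrite powRM ?mulr_ge0 ?powR_ge0 ?(ltW L0)// mulrA -/B.
rewrite /L powRM ?powR_ge0// -!powRrM kt powRr1 ?(ltW M0)// etk.
rewrite le_eqVlt; apply/orP; left; apply/eqP.
by field; rewrite gt_eqF.
Qed.

(** * Potentials of functions dominated by the densities of the system *)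

Lemma measurable_potential (f : T -> R) : measurable_fun setT f ->
  (forall x, 0 <= f x) -> measurable_fun setT (fun x => potential f x).
Proof.
move=> mf f0; apply: (measurable_fun_fubini_tonelli_F
  (fun z : T * T => (f z.2 * (D z.1 z.2 `^ (N - al))^-1)%:E)).
  apply/measurable_EFinP; apply: measurable_funM.
    exact: (measurableT_comp mf measurable_snd).
  exact: measurable_kernel.
by move=> z; rewrite lee_fin mulr_ge0// invr_ge0 powR_ge0.
Qed.

Lemma measurable_fun_potential (f : T -> R) x : measurable_fun setT f ->
  measurable_fun setT (fun y => f y * (D x y `^ (N - al))^-1).
Proof.
move=> mf; apply: measurable_funM => //.
exact: (measurableT_comp (measurable_kernel _) (measurable_pair1 x)).
Qed.

(** Domination by a function whose potential is finite everywhere makes the potential of [f] a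
    real-valued function, the form in which [gain] takes its arguments. *)
Lemma potential_fin (f g h : T -> R) b :
  measurable_fun setT f -> (forall x, 0 <= f x) -> measurable_fun setT g ->
  (forall x, 0 <= g x) -> 0 <= b -> (forall x, f x <= b * g x) ->
  (forall x, (h x)%:E = potential g x) ->
  exists V : T -> R, [/\ measurable_fun setT V, forall x, 0 <= V x,
    forall x, (V x)%:E = potential f x & forall x, V x <= b * h x].
Proof.
move=> mf f0 mg g0 b0 fg hg.
have K0 x y : 0 <= (D x y `^ (N - al))^-1 by rewrite invr_ge0 powR_ge0.
have pf0 x : (0 <= potential f x)%E.
  by apply: integral_ge0 => y _; rewrite lee_fin mulr_ge0.
have fh x : (potential f x <= (b * h x)%:E)%E.
  rewrite EFinM hg -ge0_integralMl_fin//; last 2 first.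
  - exact: measurable_fun_potential.
  - by move=> y; rewrite mulr_ge0.
  apply: ge0_le_integral_fin.
  - exact: measurable_fun_potential.
  - by move=> y; rewrite mulr_ge0.
  - by apply: measurable_funM => //; exact: measurable_fun_potential.
  - by move=> y; rewrite mulrA ler_wpM2r.
have fE x : (fine (potential f x))%:E = potential f x.
  by rewrite fineK// ge0_fin_numE// (le_lt_trans (fh x))// ltry.
exists (fun x => fine (potential f x)); split => // [|x|x].
- exact: (measurableT_comp (fine_measurable measurableT) (measurable_potential mf f0)).
- exact: fine_ge0.
- by rewrite -lee_fin fE.
Qed.

Lemma potential_leD (f g1 g2 V V1 V2 : T -> R) b :
  measurable_fun setT f -> (forall x, 0 <= f x) ->
  measurable_fun setT g1 -> (forall x, 0 <= g1 x) ->
  measurable_fun setT g2 -> (forall x, 0 <= g2 x) ->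
  0 <= b -> (forall x, f x <= b * (g1 x + g2 x)) ->
  (forall x, (V x)%:E = potential f x) ->
  (forall x, (V1 x)%:E = potential g1 x) ->
  (forall x, (V2 x)%:E = potential g2 x) ->
  forall x, V x <= b * (V1 x + V2 x).
Proof.
move=> mf f0 mg1 g10 mg2 g20 b0 fg VE V1E V2E x.
have K0 y : 0 <= (D x y `^ (N - al))^-1 by rewrite invr_ge0 powR_ge0.
have m1 := measurable_fun_potential x mg1.
have m2 := measurable_fun_potential x mg2.
have p1 y : 0 <= g1 y * (D x y `^ (N - al))^-1 by exact: mulr_ge0.
have p2 y : 0 <= g2 y * (D x y `^ (N - al))^-1 by exact: mulr_ge0.
rewrite -lee_fin EFinM EFinD VE V1E V2E -ge0_integralD_fin//.
rewrite -ge0_integralMl_fin//; last 2 first.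
- exact: measurable_funD m1 m2.
- by move=> y; exact: addr_ge0.
apply: ge0_le_integral_fin.
- exact: measurable_fun_potential.
- by move=> y; exact: mulr_ge0.
- by apply: measurable_funM => //; exact: measurable_funD m1 m2.
- by move=> y; rewrite -mulrDl mulrA ler_wpM2r.
Qed.

(** * The iteration *)

(** The invariant of the iteration: u <= max(E, G), where [e] is driven to 0 while [M] stays
    fixed. *)
Definition covered r M e := exists E G : T -> R,
  [/\ measurable_fun setT E /\ measurable_fun setT G,
      (forall x, 0 <= E x) /\ (forall x, 0 <= G x),
      forall x, u x <= E x \/ u x <= G x,
      (\int[mu]_x (E x `^ r0)%:E <= e%:E)%E &
      (\int[mu]_x (G x `^ r)%:E <= M%:E)%E].

Lemma q_gt1 : 1 < q.
Proof.
have /andP[al0 _] := al0N.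
rewrite -invf_lt1//; apply: le_lt_trans qV_le _.
by rewrite ltrBlDr ltrDl divr_gt0.
Qed.

(** One application of the operator: [gain] at exponent r0 halves the bound on E, and [gain] at
    exponent r reproduces the bound on G. The exponent [a] and the smallness [e] precede [A] because
    [A] is chosen from [e]; [M] precedes [e'], so it serves at every iteration. *)
Lemma halving r : 0 < r -> r^-1 < 1 - al / N ->
  exists a e, [/\ 0 < a, 0 < e & forall A : T -> bool, measurable_fun setT A ->
    (\int[mu]_x (if A x then u x `^ r0 else 0)%:E <= e%:E)%E ->
    (\int[mu]_x ((if A x then 0 else u x `^ p) `^ a)%:E < +oo)%E ->
    exists2 M, 0 < M & forall e', 0 < e' -> covered r M e' -> covered r M (e' / 2)].
Proof.
move=> r_gt0 rV_lt.
have [a [t [e [a0 /andP[t0 t1] e0 gr]]]] := gain r_gt0 rV_lt.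
have [a' [t' [f [a'0 _ f0 gr0]]]] := gain r0_gt0 r0V_lt.
exists a, (Num.min e f); split => //; first by rewrite lt_min e0.
move=> A mA Aef yfin.
have Ae : (\int[mu]_x (if A x then u x `^ r0 else 0)%:E <= e%:E)%E.
  by apply: le_trans Aef _; rewrite lee_fin ge_min lexx.
have Af : (\int[mu]_x (if A x then u x `^ r0 else 0)%:E <= f%:E)%E.
  by apply: le_trans Aef _; rewrite lee_fin ge_min lexx orbT.
have u0 x : 0 <= u x by exact: ltW.
pose y x := if A x then 0 else u x `^ p.
have y0 x : 0 <= y x by rewrite /y; case: ifP; rewrite // powR_ge0.
have my : measurable_fun setT y.
  by apply: measurable_fun_ifT => //; exact: measurable_powR_comp.
pose Q := fine (\int[mu]_x (y x `^ a)%:E).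
have QE : (\int[mu]_x (y x `^ a)%:E = Q%:E)%E.
  rewrite /Q fineK// ge0_fin_numE//.
  by apply: integral_ge0 => x _; rewrite lee_fin powR_ge0.
have Q0 : 0 <= Q.
  by apply: fine_ge0; apply: integral_ge0 => x _; rewrite lee_fin powR_ge0.
have et0 : 0 < e `^ t by rewrite powR_gt0.
(* [M] solves e^t M^(1 - t) = Q + 1, which meets the condition of [gain] on [y]; the added 1 keeps
   [M] positive. *)
pose M := ((Q + 1) / e `^ t) `^ (1 - t)^-1.
have M0 : 0 < M by rewrite powR_gt0// divr_gt0// ltr_wpDl.
exists M => // e' e'0 [E [G [[mE mG] [E0 G0] cov Ee GM]]].
(* Capping at [u] keeps the cover and makes the new potentials at most multiples of [v] and [u],
   hence finite. *)
pose E1 x := Num.min (E x) (u x); pose G1 x := Num.min (G x) (u x).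
have mE1 : measurable_fun setT E1 by exact: measurable_minr.
have mG1 : measurable_fun setT G1 by exact: measurable_minr.
have E10 x : 0 <= E1 x by rewrite le_min E0 u0.
have G10 x : 0 <= G1 x by rewrite le_min G0 u0.
have E1u x : E1 x <= u x by rewrite ge_min lexx orbT.
have G1u x : G1 x <= u x by rewrite ge_min lexx orbT.
have cov1 x : u x <= E1 x \/ u x <= G1 x.
  by case: (cov x) => h; [left|right]; rewrite le_min h lexx.
have r0' := ltW r0_gt0; have r' := ltW r_gt0.
have E1e : (\int[mu]_x (E1 x `^ r0)%:E <= e'%:E)%E.
  apply: le_trans Ee; apply: ge0_le_integral_fin.
  - exact: measurable_powR_comp.
  - by move=> x; exact: powR_ge0.
  - exact: measurable_powR_comp.
  - by move=> x; apply: ge0_ler_powR; rewrite ?nnegrE// ge_min lexx.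
have G1M : (\int[mu]_x (G1 x `^ r)%:E <= M%:E)%E.
  apply: le_trans GM; apply: ge0_le_integral_fin.
  - exact: measurable_powR_comp.
  - by move=> x; exact: powR_ge0.
  - exact: measurable_powR_comp.
  - by move=> x; apply: ge0_ler_powR; rewrite ?nnegrE// ge_min lexx.
pose z (F y : T -> R) x :=
  if A x then 4 * (u x `^ (p - q^-1) * F x `^ q^-1) else 4 * y x.
have mz F y' : measurable_fun setT F -> measurable_fun setT y' ->
    measurable_fun setT (z F y').
  move=> mF my'; apply: measurable_fun_ifT => //; last exact: measurable_funM.
  by apply: measurable_funM => //; apply: measurable_funM;
    exact: measurable_powR_comp.
have z0 F y' : (forall x, 0 <= y' x) -> forall x, 0 <= z F y' x.
  by move=> y'0 x; rewrite /z; case: ifP; rewrite !mulr_ge0 ?powR_ge0.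
have upE x : u x `^ (p - q^-1) * u x `^ q^-1 = u x `^ p.
  by rewrite -powRD ?subrK// (gt_eqF (u_gt0 x)) implybT.
have qV0 : 0 <= q^-1 by rewrite invr_ge0 ltW.
have zle F y' : (forall x, 0 <= F x) -> (forall x, F x <= u x) ->
    (forall x, ~~ A x -> y' x <= u x `^ p) -> forall x, z F y' x <= 4 * u x `^ p.
  move=> F0 Fu yu x; rewrite /z; case: ifPn => Ax; rewrite ler_wpM2l//; last exact: yu.
  rewrite -upE ler_wpM2l ?powR_ge0//.
  by apply: ge0_ler_powR; rewrite ?nnegrE.
have mup : measurable_fun setT (fun x => u x `^ p) by exact: measurable_powR_comp.
have up0 x : 0 <= u x `^ p by exact: powR_ge0.
have m0 : measurable_fun setT (fun _ : T => 0 : R) by exact: measurable_cst.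
have [V1 [mV1 V10 V1E V1v]] := potential_fin (mz _ _ mE1 m0) (z0 E1 _ (fun=> lexx 0))
  mup up0 (ler0n _ 4) (zle E1 _ E10 E1u (fun x _ => up0 x)) vE.
have yu x : ~~ A x -> y x <= u x `^ p by rewrite /y => /negbTE ->.
have [V2 [mV2 V20 V2E V2v]] := potential_fin (mz _ _ mG1 my) (z0 G1 _ y0) mup up0
  (ler0n _ 4) (zle G1 _ G10 G1u yu) vE.
(* The factor 4 built into [z] leaves 1/4 here. One half turns V1 + V2 into a maximum; the other
   survives the power q, as q > 1, and later turns E2 + G2 into a maximum. *)
have vV x : v x <= 4^-1 * (V1 x + V2 x).
  move: x; apply: (potential_leD mup up0 (mz _ _ mE1 m0) (z0 E1 _ (fun=> lexx 0))
    (mz _ _ mG1 my) (z0 G1 _ y0) _ _ vE V1E V2E); first by rewrite invr_ge0.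
  move=> x; rewrite /z /y; case: ifPn => Ax; last by lra.
  rewrite -mulrDr mulrA mulVf// mul1r -upE -mulrDr ler_wpM2l ?powR_ge0//.
  by case: (cov1 x) => h; [rewrite ler_wpDr ?powR_ge0//|rewrite ler_wpDl ?powR_ge0//];
    apply: ge0_ler_powR; rewrite ?nnegrE.
have q1 := q_gt1; have q0 := ltW q_gt0.
have v0 x : 0 <= v x by exact: ltW.
have mVq (V : T -> R) : measurable_fun setT V -> measurable_fun setT (fun x => V x `^ q).
  by move=> mV; exact: measurable_powR_comp.
have Vq0 (V : T -> R) x : 0 <= V x `^ q by exact: powR_ge0.
have Vq (V : T -> R) : (forall x, 0 <= V x) -> (forall x, V x <= 4 * v x) ->
    forall x, V x `^ q <= 4 `^ q * v x `^ q.
  move=> V0 Vv x; rewrite -powRM//; apply: ge0_ler_powR; rewrite ?nnegrE//.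
  by rewrite mulr_ge0.
have [E2 [mE2 E20 E2E _]] := potential_fin (mVq _ mV1) (Vq0 V1) (mVq _ v_meas) (Vq0 v)
  (powR_ge0 _ _) (Vq _ V10 V1v) uE.
have [G2 [mG2 G20 G2E _]] := potential_fin (mVq _ mV2) (Vq0 V2) (mVq _ v_meas) (Vq0 v)
  (powR_ge0 _ _) (Vq _ V20 V2v) uE.
have half q' : 1 <= q' -> 2^-1 `^ q' <= (2^-1 : R).
  by move=> q'1; apply: ge1r_powR => //; lra.
have uEG x : u x <= 2^-1 * (E2 x + G2 x).
  move: x; apply: (potential_leD (mVq _ v_meas) (Vq0 v) (mVq _ mV1) (Vq0 V1)
    (mVq _ mV2) (Vq0 V2) _ _ uE E2E G2E); first by rewrite invr_ge0.
  have aux x V V' : 0 <= V -> 0 <= V' -> v x <= 2^-1 * V ->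
      v x `^ q <= 2^-1 * (V `^ q + V' `^ q).
    move=> V0 V'0 vx; apply: (@le_trans _ _ ((2^-1 * V) `^ q)).
      by apply: ge0_ler_powR; rewrite ?nnegrE ?mulr_ge0// invr_ge0.
    rewrite powRM ?invr_ge0//; apply: ler_pM; rewrite ?powR_ge0//.
      by apply: half; exact: ltW.
    by rewrite lerDl powR_ge0.
  move=> x; have := vV x; case: (leP (V1 x) (V2 x)) => V12 vx.
    by rewrite addrC; apply: aux => //; lra.
  by apply: aux => //; lra.
exists E2, G2; split; [by split|by split| | |].
- move=> x; have := uEG x; case: (leP (E2 x) (G2 x)) => EG ux; [right|left]; lra.
(* With y = 0 the only bound that scales is that on E1, so the same threshold [f] works for every
   [e']. *)
- apply: (gr0 A E1 (fun=> 0) V1 E2) => //.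
  + by move=> x; rewrite V1E.
  + by move=> x; rewrite E2E.
  + under eq_integral do rewrite powR0 ?gt_eqF//.
    by rewrite integral0 lee_fin mulr_ge0// powR_ge0.
- apply: (@le_trans _ _ (M / 2)%:E); last first.
    by rewrite lee_fin; lra.
  apply: (gr A G1 y V2 G2) => //.
  + by move=> x; rewrite V2E.
  + by move=> x; rewrite G2E.
  + rewrite QE lee_fin /M -powRrM mulVf ?subr_eq0 ?(gt_eqF t1)// powRr1; last first.
      by rewrite divr_ge0 ?powR_ge0// addr_ge0.
    by rewrite mulrC divfK ?gt_eqF//; lra.
Qed.


(** These increasing sets exhaust the space, as u is positive and finite, and on each of them all
    powers of u are comparable. The successor keeps the bound at least 1. *)
Let Bd (n : nat) x : bool := (n.+1%:R^-1 <= u x) && (u x <= n.+1%:R).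

Let Bd_near x : \forall n \near \oo, Bd n x.
Proof.
have ux := u_gt0 x; near=> n; rewrite /Bd.
have h1 : u x < n%:R by near: n; exact: nbhs_infty_gtr.
have h2 : (u x)^-1 < n%:R by near: n; exact: nbhs_infty_gtr.
have n1 : (n%:R : R) <= n.+1%:R by rewrite ler_nat.
apply/andP; split; last by apply/ltW/(lt_le_trans h1).
rewrite -[leRHS]invrK lef_pV2 ?posrE ?ltr0n ?invr_gt0//.
by apply/ltW/(lt_le_trans h2).
Unshelve. all: by end_near. Qed.

Let mBd n : measurable_fun setT (Bd n).
Proof.
apply: measurable_and.
  exact: (measurable_fun_ler (measurable_cst _) u_meas).
exact: (measurable_fun_ler u_meas (measurable_cst _)).
Qed.

Let Bd_mono x n m : (n <= m)%N -> Bd n x -> Bd m x.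
Proof.
move=> nm /andP[h1 h2]; have nm' : n.+1%:R <= m.+1%:R :> R by rewrite ler_nat.
rewrite /Bd (le_trans h2 nm') andbT (le_trans _ h1)//.
by rewrite lef_pV2 ?posrE ?ltr0n.
Qed.

Let Bd_le n r s x : Bd n x -> u x `^ r <= n.+1%:R `^ `|r - s| * u x `^ s.
Proof. by move=> h; apply: powR_le_comparable => //; rewrite ler1n. Qed.

Let integral_le_Bd (f : T -> R) (M : \bar R) : measurable_fun setT f ->
  (forall x, 0 <= f x) ->
  (forall n, \int[mu]_x (if Bd n x then f x else 0)%:E <= M)%E ->
  (\int[mu]_x (f x)%:E <= M)%E.
Proof.
move=> mf f0; apply: integral_le_lim.
- by move=> n; exact: measurable_fun_ifT.
- by move=> n x; case: ifP.
- move=> x n m nm; case: ifPn => [/(Bd_mono nm) -> //|_]; by case: ifP.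
- by move=> x; near=> n; rewrite ifT//; near: n; exact: Bd_near.
Unshelve. all: by end_near. Qed.

Let mur s : measurable_fun setT (fun x => u x `^ s).
Proof. exact: measurable_powR_comp. Qed.

(** Otherwise the integral of u^r0 over every [Bd n] is at most I - e, and so is its limit I. *)
Lemma small_tail e : 0 < e -> exists n,
  (\int[mu]_x (if ~~ Bd n x then u x `^ r0 else 0)%:E <= e%:E)%E.
Proof.
move=> e0; apply/not_existsP => H.
have ur0 x : 0 <= u x `^ r0 by exact: powR_ge0.
pose f n x := if Bd n x then u x `^ r0 else 0.
pose g n x := if ~~ Bd n x then u x `^ r0 else 0.
have f0 n x : 0 <= f n x by rewrite /f; case: ifP.
have g0 n x : 0 <= g n x by rewrite /g; case: ifP.
have mf n : measurable_fun setT (f n) by exact: measurable_fun_ifT.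
have mg n : measurable_fun setT (g n).
  by apply: measurable_fun_ifT => //; exact: measurable_neg.
pose I := fine (\int[mu]_x (u x `^ r0)%:E).
have IE : (\int[mu]_x (u x `^ r0)%:E = I%:E)%E.
  by rewrite /I fineK// ge0_fin_numE// integral_ge0// => x _; rewrite lee_fin.
have split n : (\int[mu]_x (f n x)%:E + \int[mu]_x (g n x)%:E = I%:E)%E.
  rewrite -IE -ge0_integralD_fin//; apply: eq_integral => x _; congr (_%:E).
  by rewrite /f /g; case: (Bd n x); rewrite ?addr0 ?add0r.
suff : (\int[mu]_x (u x `^ r0)%:E <= (I - e)%:E)%E.
  by rewrite IE lee_fin; lra.
apply: integral_le_Bd => // n.
have := H n; have := split n; rewrite -/(f n) -/(g n).
have F0 : (0 <= \int[mu]_x (f n x)%:E)%E.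
  by apply: integral_ge0 => x _; rewrite lee_fin.
have G0 : (0 <= \int[mu]_x (g n x)%:E)%E.
  by apply: integral_ge0 => x _; rewrite lee_fin.
case: (\int[mu]_x (f n x)%:E)%E F0 => [a| |]//= _;
  case: (\int[mu]_x (g n x)%:E)%E G0 => [b| |]//= _.
by move=> [abI] /negP; rewrite lee_fin -ltNge => be; rewrite lee_fin; lra.
Qed.

(** The set [A] is the complement of a [Bd n] with small tail; off [A], powers of u are comparable,
    so u^p is in L^a there. The iteration starts from E = u, G = 0, and its k-th cover has E-bound
    (I + 1) / 2^k. *)
Lemma lifting r : 0 < r -> r^-1 < 1 - al / N ->
  (\int[mu]_x (u x `^ r)%:E < +oo)%E.
Proof.
move=> r_gt0 rV_lt.
have ur0 s x : 0 <= u x `^ s by exact: powR_ge0.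
have [a [e [a0 e0 Hh]]] := halving r_gt0 rV_lt.
have [n small] := small_tail e0.
pose I := fine (\int[mu]_x (u x `^ r0)%:E).
have IE : (\int[mu]_x (u x `^ r0)%:E = I%:E)%E.
  by rewrite /I fineK// ge0_fin_numE// integral_ge0// => x _; rewrite lee_fin.
have I0 : 0 <= I by rewrite -lee_fin -IE integral_ge0// => x _; rewrite lee_fin.
have mnB m : measurable_fun setT (fun x => ~~ Bd m x).
  exact: measurable_neg.
have {Hh} [|M M0 step] := Hh (fun x => ~~ Bd n x) (mnB n) small.
  pose b : R := n.+1%:R `^ `|p * a - r0|.
  apply: (@le_lt_trans _ _ (\int[mu]_x (b * u x `^ r0)%:E)%E); last first.
    by rewrite ge0_integralMl_fin ?powR_ge0// IE -EFinM ltry.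
  apply: ge0_le_integral_fin.
  - by apply: measurable_powR_comp; exact: measurable_fun_ifT.
  - by move=> x; exact: powR_ge0.
  - exact: measurable_funM.
  - move=> x; case: ifPn => [_|/negPn Bx].
      by rewrite powR0 ?gt_eqF// mulr_ge0 ?powR_ge0.
    by rewrite -powRrM; exact: Bd_le.
have cov k : covered r M ((I + 1) / 2 ^+ k).
  elim: k => [|k IH].
    exists u, (fun=> 0); split.
    - by split.
    - by split => x //; exact: ltW.
    - by move=> x; left.
    - by rewrite IE lee_fin expr0 divr1; lra.
    - under eq_integral do rewrite powR0 ?gt_eqF//.
      by rewrite integral0 lee_fin ltW.
  rewrite exprSr invfM mulrA; apply: step => //.
  by rewrite divr_gt0 ?exprn_gt0//; lra.
apply: (@le_lt_trans _ _ M%:E); last exact: ltry.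
apply: integral_le_Bd => // m.
(* On [Bd m], u^r <= G^r + b E^r0 with [b] depending on m alone; k is chosen after m so that b times
   the bound on E is at most [w]. *)
pose b : R := m.+1%:R `^ `|r - r0|.
have b0 : 0 < b by rewrite powR_gt0.
apply/lee_addgt0Pr => w w0.
have [k hk] : exists k, b * ((I + 1) / 2 ^+ k) <= w.
  have X0 : 0 <= b * (I + 1) / w by rewrite !mulr_ge0 ?invr_ge0 ?ltW//; lra.
  have kt := Num.Theory.truncnS_gt (b * (I + 1) / w).
  exists (Num.truncn (b * (I + 1) / w)).+1; move: (Num.truncn _).+1 kt => k kt.
  have kX : b * (I + 1) / w < 2 ^+ k.
    apply: lt_le_trans kt _.
    by rewrite -natrX ler_nat; exact/ltnW/ltn_expl.
  by rewrite mulrA ler_pdivrMr ?exprn_gt0// [w * _]mulrC -ler_pdivrMr// ltW.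
have [E [G [[mE mG] [E0 G0] cv Ee GM]]] := cov k.
have mEr := measurable_powR_comp r0 mE; have mGr := measurable_powR_comp r mG.
apply: (@le_trans _ _ (\int[mu]_x (G x `^ r + b * E x `^ r0)%:E)%E).
  apply: ge0_le_integral_fin.
  - exact: measurable_fun_ifT.
  - by move=> x; case: ifP.
  - by apply: (measurable_funD mGr); exact: measurable_funM.
  - move=> x; case: ifPn => Bx; last first.
      by rewrite addr_ge0 ?powR_ge0// mulr_ge0 ?powR_ge0// ltW.
    case: (cv x) => ux.
      apply: ler_wpDl; first exact: powR_ge0.
      apply: le_trans (Bd_le r r0 Bx) _; rewrite ler_wpM2l ?powR_ge0//.
      by apply: ge0_ler_powR; rewrite ?nnegrE ?(ltW r0_gt0) ?(ltW (u_gt0 x)).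
    apply: ler_wpDr; first by rewrite mulr_ge0 ?powR_ge0// ltW.
    by apply: ge0_ler_powR; rewrite ?nnegrE ?(ltW r_gt0) ?(ltW (u_gt0 x)).
rewrite ge0_integralD_fin//; last 3 first.
- by move=> x; exact: powR_ge0.
- exact: measurable_funM.
- by move=> x; rewrite mulr_ge0 ?powR_ge0// ltW.
rewrite ge0_integralMl_fin//; last 2 first.
- by move=> x; exact: powR_ge0.
- exact: ltW.
apply: leeD => //; apply: (@le_trans _ _ (b%:E * ((I + 1) / 2 ^+ k)%:E)%E).
  by apply: lee_wpmul2l => //; rewrite lee_fin ltW.
by rewrite -EFinM lee_fin.
Qed.

(** For v = I(u^p) in L^s one needs u^p in L^a with 1/a = 1/s + al/N, that is u in L^(p a); the last
    condition on [s] says that p a is within the range of [lifting]. *)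
Lemma lifting_dual s : 0 < p -> 0 < s -> s^-1 < 1 - al / N ->
  (s^-1 + al / N) / p < 1 - al / N -> (\int[mu]_x (v x `^ s)%:E < +oo)%E.
Proof.
move=> p0 s0 s1 sp; have /andP[al0 alN] := al0N.
have be0 : 0 < al / N by rewrite divr_gt0.
have sV0 : 0 < s^-1 by rewrite invr_gt0.
pose a := (s^-1 + al / N)^-1.
have aV : a^-1 = s^-1 + al / N by rewrite invrK.
have a0 : 0 < a by rewrite invr_gt0 addr_gt0.
have a1 : 1 < a by rewrite -invf_lt1// aV; lra.
have sE : s^-1 = a^-1 - al / N by rewrite aV addrK.
have [C C0 vC] := hls al0N a1 s0 sE.
have ufin : (\int[mu]_x (u x `^ (p * a))%:E < +oo)%E.
  by apply: lifting; rewrite ?mulr_gt0// invfM aV mulrC.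
pose A := fine (\int[mu]_x (u x `^ (p * a))%:E) + 1.
have I0 : (0 <= \int[mu]_x (u x `^ (p * a))%:E)%E.
  by apply: integral_ge0 => x _; rewrite lee_fin powR_ge0.
have A0 : 0 < A by rewrite ltr_wpDl// fine_ge0.
apply: (@le_lt_trans _ _ (C * A `^ (s / a))%:E); last exact: ltry.
apply: (vC (fun x => u x `^ p)) => //.
- by move=> x; exact: powR_ge0.
- by move=> x; exact/ltW.
- by move=> x; rewrite vE.
- under eq_integral do rewrite -powRrM.
  have -> : (\int[mu]_x (u x `^ (p * a))%:E = (A - 1)%:E)%E.
    by rewrite addrK fineK// ge0_fin_numE.
  by rewrite lee_fin; lra.
Qed.

End riesz_potential.

(** * Coordinates, Borel functions and a product model of R^n *)

Lemma coord_le_enorm (R : realType) (n : nat) (x : 'rV[R]_n) i :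
  `|x ord0 i| <= enorm x.
Proof.
rewrite -sqrtr_sqr; apply: ler_wsqrtr.
by rewrite (bigD1 i)//= lerDl sumr_ge0// => j _; rewrite sqr_ge0.
Qed.

Lemma enormB_sym (R : realType) (n : nat) (x y : 'rV[R]_n) :
  enorm (x - y) = enorm (y - x).
Proof.
by congr Num.sqrt; apply: eq_bigr => i _; rewrite -sqrrN !mxE opprB.
Qed.

Section coordinates.
Context {d : measure_display} {T : measurableType d} {R : realType} {n : nat}.
Variable phi : T -> 'rV[R]_n.
Hypothesis mphi : forall i, measurable_fun setT (fun x => phi x ord0 i).

Lemma measurable_enorm (a : T -> 'rV[R]_n) :
  (forall i, measurable_fun setT (fun x => a x ord0 i)) ->
  measurable_fun setT (fun x => enorm (a x)).
Proof.
move=> ma; apply: (@measurableT_comp _ _ _ _ _ _ (@Num.sqrt R)).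
  by apply: continuous_measurable_fun; exact: sqrt_continuous.
by apply: measurable_sum => i; exact: measurable_funX.
Qed.

Lemma measurable_box (c : 'rV[R]_n) (s : R) :
  measurable [set x | (forall i, `|c ord0 i - phi x ord0 i| < s)%R].
Proof.
rewrite (_ : mkset _ = \bigcap_(i in [set: 'I_n])
    [set x | `|c ord0 i - phi x ord0 i| < s]); last first.
  by apply/seteqP; split => [x Bx i _|x Bx i]; exact: Bx.
apply: fin_bigcap_measurable; first exact: finite_finset.
move=> i _.
have m : measurable_fun setT (fun x => `|c ord0 i - phi x ord0 i| < s).
  apply: (measurable_fun_ltr _ (measurable_cst _)).
  apply: measurableT_comp => //.
  exact: (measurable_funB (measurable_cst _) (mphi i)).
by have := m measurableT [set true]; rewrite setTI; apply.
Qed.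

(** The sets with measurable preimage under [phi] form a sigma-algebra containing the rectangles
    that generate [borel_n]. *)
Lemma borel_fun_comp (f : 'rV[R]_n -> R) :
  borel_fun f -> measurable_fun setT (f \o phi).
Proof.
move=> bf _ B mB; rewrite setTI comp_preimage.
suff H : borel_n (n := n) `<=` [set A | measurable (phi @^-1` A)] by exact: H (bf _ mB).
apply: smallest_sub.
  split => [|A|F]; rewrite /= ?preimage_set0//.
  - by move=> mA; rewrite setTD preimage_setC; exact: measurableC.
  - by move=> mF; rewrite preimage_bigcup; exact: bigcup_measurable.
move=> _ [B' [mB' ->]] /=.
rewrite (_ : _ @^-1` _ = \bigcap_(i in [set: 'I_n])
    ((fun x => phi x ord0 i) @^-1` B' i)); last first.
  by apply/seteqP; split => [x Bx i _|x Bx i]; exact: Bx.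
apply: fin_bigcap_measurable; first exact: finite_finset.
by move=> i _; rewrite -[X in measurable X]setTI; exact: mphi.
Qed.

End coordinates.

(* The library's sigma-finite structure on [m1 \x m2] is shadowed by its
   instance for subprobabilities, whence a separate constant. *)
Section sigma_finite_product.
Context {d1 d2 : measure_display} {T1 : measurableType d1}
  {T2 : measurableType d2} {R : realType}.
Variable m1 : {sigma_finite_measure set T1 -> \bar R}.
Variable m2 : {sigma_finite_measure set T2 -> \bar R}.

Definition sfprod : set (T1 * T2) -> \bar R := (m1 \x m2)%E.

HB.instance Definition _ := Measure.on sfprod.

Let sfprod_sigma_finite : sigma_finite setT sfprod.
Proof.
have [F FT Foo] := sigma_finiteT m1; have [G GT Goo] := sigma_finiteT m2.
exists (fun n => if @unpickle (nat * nat)%type n is Some k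
    then F k.1 `*` G k.2 else set0).
  apply/esym/seteqP; split => // -[x y] _.
  have [i _ Fx] : (\bigcup_i F i) x by rewrite -FT.
  have [j _ Gy] : (\bigcup_i G i) y by rewrite -GT.
  by exists (pickle (i, j)) => //; rewrite pickleK.
move=> n; case: unpickle => [[i j]|] /=; last by rewrite measure0; split.
have [mF Fi] := Foo i; have [mG Gj] := Goo j.
split; first exact: measurableX.
by rewrite /sfprod product_measure1E// lte_mul_pinfty// ge0_fin_numE.
Qed.

HB.instance Definition _ :=
  Measure_isSigmaFinite.Build _ _ _ sfprod sfprod_sigma_finite.

End sigma_finite_product.

(* [T] is an iterated product of copies of [R]; presenting [iint] as an integral
   for a sigma-finite measure gives access to Tonelli's theorem. *)
Lemma iint_model (R : realType) (n : nat) :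
  exists (d : measure_display) (T : measurableType d)
    (mu : {sigma_finite_measure set T -> \bar R}) (phi : T -> 'rV[R]_n),
  [/\ forall i, measurable_fun setT (fun x => phi x ord0 i),
    forall f : 'rV[R]_n -> \bar R, (forall y, 0 <= f y)%E ->
      measurable_fun setT (f \o phi) -> iint f = (\int[mu]_x f (phi x))%E &
    forall (c : 'rV[R]_n) (s : R), 0 < s ->
      (mu [set x | (forall i, `|c ord0 i - phi x ord0 i| < s)%R] <=
        ((2 * s) ^+ n)%:E)%E].
Proof.
elim: n => [|n [d [T [mu [phi [mphi iphi bphi]]]]]].
  (* In dimension 0 the iterated integral is evaluation at the only point, hence a Dirac mass. *)
  exists _, unit, (@dirac _ unit tt R), (fun=> 0); split.
  - by case.
  - move=> f f0 mf /=.
    by rewrite integral_dirac//= diracT mul1e.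
  - move=> c s s0; rewrite expr0 /= diracE.
    by rewrite lee_fin; case: (_ \in _); rewrite ?lexx ?ler01.
pose psi (z : R * T) : 'rV[R]_(1 + n) := row_mx (\row_(j < 1) z.1) (phi z.2).
have psiE (z : R * T) (i : 'I_(1 + n)) : psi z ord0 i =
    match fintype.split i with inl _ => z.1 | inr k => phi z.2 ord0 k end.
  by rewrite /psi mxE; case: fintype.split => // k; rewrite mxE.
pose L : {sigma_finite_measure set (measurableTypeR R) -> \bar R} :=
  @lebesgue_measure R.
exists _, (measurableTypeR R * T)%type, (sfprod L mu), psi; split.
- move=> i; under eq_fun do rewrite psiE.
  case: (fintype.split (i : 'I_(1 + n))) => [_|k]; first exact: measurable_fst.
  exact: (measurableT_comp (mphi k) measurable_snd).
- move=> f f0 mf /=.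
  have f0' z : (0 <= (f \o psi) z)%E by exact: f0.
  apply: (eq_trans _ (esym (fubini_tonelli1 (m1 := L) (m2 := mu) _ mf f0'))).
  apply: eq_integral => t _; rewrite iphi//; last first.
    exact: (measurableT_comp mf (measurable_pair1 t)).
(* The measure bound is carried for boxes because a box is an interval of length 2 s times a box of
   one dimension less. *)
- move=> c s s0.
  pose B := [set x | forall i, `|rsubmx (c : 'rV_(1 + n)) ord0 i - phi x ord0 i| < s].
  pose I := ball (c ord0 ord0) s.
  have mB : measurable B by exact: measurable_box.
  rewrite (_ : mkset _ = I `*` B); last first.
    apply/seteqP; split => [z zs|z [zI zB] i] /=.
      split => [|k].
        have := zs (@lshift 1 n ord0); rewrite psiE (unsplitK (inl _)).
        rewrite /I -ball_normE /= (_ : @lshift 1 n ord0 = ord0)//; exact/val_inj.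
      by have := zs (@rshift 1 n k); rewrite psiE (unsplitK (inr k)) mxE.
    rewrite psiE; case: split_ordP => k ->.
      move: zI; rewrite /I -ball_normE /=.
      by rewrite (_ : lshift n k = ord0)//; apply/val_inj; rewrite /= ord1.
    by have := zB k; rewrite mxE.
  apply: (@le_trans _ _ (L I * mu B)%E).
    rewrite le_eqVlt; apply/orP; left; apply/eqP.
    exact: (product_measure1E L mu (measurable_ball _ _) mB).
  have -> : L I = (2 * s)%:E.
    by rewrite mulr_natl; exact: (lebesgue_measure_ball _ (ltW s0)).
  rewrite exprS [X in (_ <= X)%E]EFinM; apply: lee_wpmul2l; last exact: bphi.
  by rewrite lee_fin mulr_ge0// ltW.
Qed.

(** * Application to the system on R^n *)

Theorem theorem2p1 (R : realType) (n : nat) (alpha p q : R)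
  (u v : 'rV[R]_n -> R) :
  (3 <= n)%N ->
  0 < alpha -> alpha < n%:R ->
  0 < p -> 0 < q -> 1 < p * q -> p <= q ->
  (p + 1)^-1 + (q + 1)^-1 <= (n%:R - alpha) / n%:R ->
  (* (u, v) is a pair of positive (measurable) solutions *)
  borel_fun u -> borel_fun v ->
  (forall x, 0 < u x) -> (forall x, 0 < v x) ->
  (forall x, (u x)%:E = riesz alpha (fun y => v y `^ q) x) ->
  (forall x, (v x)%:E = riesz alpha (fun y => u y `^ p) x) ->
  (* (u, v) in L^{r0} x L^{s0} *)
  inLp (n%:R * (p * q - 1) / (alpha * (q + 1))) u ->
  inLp (n%:R * (p * q - 1) / (alpha * (p + 1))) v ->
  forall r s : R,
    0 < r^-1 -> r^-1 < (n%:R - alpha) / n%:R ->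
    0 < s^-1 -> s^-1 < Num.min ((n%:R - alpha) / n%:R)
                               ((p * n%:R - (p + 1) * alpha) / n%:R) ->
    inLp r u /\ inLp s v.
Proof.
move=> n3 al0 aln p0 q0 pq1 pq hyp bu bv u0 v0 uE vE [_ ur0] _ r s.
rewrite !invr_gt0 lt_min => r0 rV s0 /andP[sV sp].
set N : R := n%:R in al0 aln hyp ur0 rV sV sp *.
have N0 : 0 < N by rewrite ltr0n; exact: leq_trans n3.
have NE : (N - alpha) / N = 1 - alpha / N by rewrite mulrBl mulfV// gt_eqF.
rewrite NE in hyp rV sV.
have q1 : 1 < q by nra.
have pqm0 : 0 < p * q - 1 by lra.
have p10 : 0 < p + 1 by lra.
have q10 : 0 < q + 1 by lra.
have q1V0 : 0 < (q + 1)^-1 by rewrite invr_gt0.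
(* From p <= q the sum of reciprocals is at least 2 / (q + 1), which is at least 1/q because q >
   1. *)
have qV : q^-1 <= 1 - alpha / N.
  apply: le_trans hyp.
  have h : (q + 1)^-1 <= (p + 1)^-1 by rewrite lef_pV2 ?posrE//; lra.
  apply: (@le_trans _ _ ((q + 1)^-1 + (q + 1)^-1)); last by rewrite lerD2r.
  rewrite -mulr2n -mulr_natl ler_pdivlMr// mulrC ler_pdivrMr//; lra.
set t := N * (p * q - 1) / (alpha * (q + 1)) in ur0.
have t0 : 0 < t by rewrite divr_gt0 ?mulr_gt0.
(* Here [t] is r0. Its reciprocal increases with alpha / N and equals 1 / (p + 1) at the largest
   value allowed, 1 - 1/(p + 1) - 1/(q + 1). *)
have tV : t^-1 < 1 - alpha / N.
  have h : alpha / N <= 1 - (p + 1)^-1 - (q + 1)^-1 by lra.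
  apply: (@le_lt_trans _ _ (p + 1)^-1); last by lra.
  rewrite /t invf_div (_ : _ / _ = alpha / N * ((q + 1) / (p * q - 1))); last first.
    by field; rewrite !gt_eqF.
  rewrite (_ : (p + 1)^-1 =
    (1 - (p + 1)^-1 - (q + 1)^-1) * ((q + 1) / (p * q - 1))); last first.
    by field; rewrite !gt_eqF.
  by rewrite ler_wpM2r// divr_ge0// ltW.
have tE : (p - q^-1) / t = alpha / N * (1 + q^-1).
  by rewrite /t; field; rewrite !gt_eqF.
(* The second bound on 1/s, rewritten as the range condition of [lifting_dual]. *)
have sp' : (s^-1 + alpha / N) / p < 1 - alpha / N.
  rewrite ltr_pdivrMr//; move: sp.
  rewrite (_ : _ / N = (1 - alpha / N) * p - alpha / N); first lra.
  by field; rewrite gt_eqF.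
have [d [T [mu [phi [mphi iphi bphi]]]]] := iint_model R n.
pose D x y := enorm (phi x - phi y).
have D_sym x y : D x y = D y x by exact: enormB_sym.
have D_ge0 x y : 0 <= D x y by exact: sqrtr_ge0.
have mD : measurable_fun setT (fun z : T * T => D z.1 z.2).
  apply: measurable_enorm => i; under eq_fun do rewrite !mxE.
  apply: measurable_funB.
    exact: (measurableT_comp (mphi i) measurable_fst).
  exact: (measurableT_comp (mphi i) measurable_snd).
have c0 : 0 < (2 : R) ^+ n by rewrite exprn_gt0.
(* A Euclidean ball lies in the box of the same radius, which gives the constant 2^n. *)
have mu_ball x e : 0 < e ->
    (mu [set y | (D x y < e)%R] <= (2 ^+ n * e `^ N)%:E)%E.
  move=> e0; rewrite powR_mulrn ?(ltW e0)// -exprMn.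
  apply: le_trans (bphi (phi x) _ e0); apply: le_measure; rewrite ?inE.
  - exact: measurable_dball.
  - exact: measurable_box.
  - move=> y /= Dy i; apply: le_lt_trans Dy.
    by have := coord_le_enorm (phi x - phi y) i; rewrite !mxE.
have alN : 0 < alpha < N by rewrite al0.
have mu' : measurable_fun setT (u \o phi) by exact: borel_fun_comp.
have mv' : measurable_fun setT (v \o phi) by exact: borel_fun_comp.
have pot (f : 'rV[R]_n -> R) k x : (forall y, 0 <= f y) ->
    measurable_fun setT (f \o phi) ->
    riesz alpha (fun y => f y `^ k) (phi x) =
    (\int[mu]_y (f (phi y) `^ k * (D x y `^ (N - alpha))^-1)%:E)%E.
  move=> f0 mf; apply: iphi.
    by move=> y; rewrite lee_fin divr_ge0 ?powR_ge0.
  apply/measurable_EFinP; apply: measurable_funM.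
    exact: measurable_powR_comp.
  exact: (measurableT_comp (measurable_kernel mD _) (measurable_pair1 x)).
have u0' x : 0 < (u \o phi) x by exact: u0.
have v0' x : 0 < (v \o phi) x by exact: v0.
have uE' x : ((u \o phi) x)%:E =
    (\int[mu]_y ((v \o phi) y `^ q * (D x y `^ (N - alpha))^-1)%:E)%E.
  by rewrite /= uE pot// => y; exact: ltW.
have vE' x : ((v \o phi) x)%:E =
    (\int[mu]_y ((u \o phi) y `^ p * (D x y `^ (N - alpha))^-1)%:E)%E.
  by rewrite /= vE pot// => y; exact: ltW.
have norm (f : 'rV[R]_n -> R) k : (forall y, 0 < f y) ->
    measurable_fun setT (f \o phi) ->
    iint (fun x => (`|f x| `^ k)%:E) = (\int[mu]_x ((f \o phi) x `^ k)%:E)%E.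
  move=> f0 mf.
  under [in LHS]eq_fun do rewrite gtr0_norm//.
  apply: iphi; first by move=> y; rewrite lee_fin powR_ge0.
  by apply/measurable_EFinP; exact: measurable_powR_comp.
rewrite norm// in ur0.
have up := lifting D_sym D_ge0 mD N0 c0 mu_ball alN q0 qV t0 tV tE
  mu' mv' u0' v0' uE' vE' ur0.
have vp := lifting_dual D_sym D_ge0 mD N0 c0 mu_ball alN q0 qV t0 tV tE
  mu' mv' u0' v0' uE' vE' ur0.
split; split => //; rewrite norm//; first exact: up.
exact: vp.
Qed.
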